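(* For every $m\ge1$ and $N_1,N_2\ge0$, the space of conjugate polynomials in $\mathbb{C}[x_f,\overline{x_f}:f\in\mathbb{F}_2^m]$ that are homogeneous of degree $(N_1,N_2)$ and invariant under the complex Clifford group $\mathcal{X}_m$ is spanned by the polynomials $\mathrm{ccwe}(C(m))$, where $C$ ranges over all binary doubly-even self-dual codes of length $(N_1,N_2)$. If moreover $m+1\ge (N_1+N_2)/2$, then the polynomials $\mathrm{ccwe}(C(m))$, with $C$ ranging over a set of representatives of the equivalence classes of such codes, form a basis of this space.
   Context: A binary code of length $(N_1,N_2)$ is an $\mathbb{F}_2$-subspace $C\le\mathbb{F}_2^{N_1+N_2}$. $\beta(x,y)=\sum_{j\le N_1}x_jy_j-\sum_{j>N_1}x_jy_j\in\mathbb{F}_2$, $C^\perp=\{y:\beta(c,y)=0\ \forall c\in C\}$, $C$ self-dual if $C=C^\perp$. $\mathrm{wt}(c)=\sum_{j\le N_1}c_j-\sum_{j>N_1}c_j\in\mathbb{Z}$ (entries read as integers $0,1$); $C$ doubly-even if all weights are divisible by $4$. Two codes are equivalent if one is obtained from the other by permuting the first $N_1$ coordinates among themselves and the last $N_2$ coordinates among themselves. The complex Clifford group $\mathcal{X}_m\le U(2^m)$: with $(e_v)_{v\in\mathbb{F}_2^m}$ an orthonormal basis of $\mathbb{C}^{2^m}$, $\mathcal{X}_m$ is generated by $d_S:e_v\mapsto i^{v^TSv}e_v$ ($S$ symmetric integral $m\times m$), $m_{g,v'}:e_v\mapsto e_{gv+v'}$ ($(g,v')\in\mathrm{GL}(m,2)\ltimes\mathbb{F}_2^m$),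 and $h\otimes I_2\otimes\cdots\otimes I_2$ with $h=\frac1{\sqrt2}\begin{bmatrix}1&1\\1&-1\end{bmatrix}$. $g=(g_{wv})\in U(2^m)$ acts on the polynomial ring $\mathbb{C}[x_f,\overline{x_f}:f\in\mathbb{F}_2^m]$ (independent indeterminates) by the ring automorphism $x_v\mapsto\sum_w g_{wv}x_w$, $\overline{x_v}\mapsto\sum_w\overline{g_{wv}}\,\overline{x_w}$; homogeneous of degree $(N_1,N_2)$ means degree $N_1$ in the $x_f$ and $N_2$ in the $\overline{x_f}$. For an $m\times(N_1+N_2)$ matrix $M$ over $\mathbb{F}_2$ with columns $M_j\in\mathbb{F}_2^m$, $\nu_M=\prod_{j\le N_1}x_{M_j}\prod_{j>N_1}\overline{x_{M_j}}$; $\mathrm{ccwe}(C(m))=\sum\nu_M$ over all such $M$ all of whose rows lie in $C$. *)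

(* Defs.v *)
From HB Require Import structures.
From mathcomp Require Import all_boot all_order all_algebra all_fingroup.
From mathcomp Require Import mpoly.
Set Implicit Arguments. Unset Strict Implicit. Unset Printing Implicit Defensive.
Import Order.TTheory GRing.Theory Num.Theory.
Local Open Scope ring_scope.

(* A word of length N1+N2 over F_2; coordinate j is "first block" iff j < N1. *)
Definition word (N1 N2 : nat) := 'rV['F_2]_(N1 + N2).

Definition is_code (N1 N2 : nat) (C : {set word N1 N2}) : Prop :=
  [/\ 0 \in C,
      (forall x y, x \in C -> y \in C -> x + y \in C) &
      (forall (a : 'F_2) x, x \in C -> a *: x \in C)].

Definition beta (N1 N2 : nat) (x y : word N1 N2) : 'F_2 :=
  \sum_(j < N1 + N2 | (j < N1)%N) x 0 j * y 0 j
  - \sum_(j < N1 + N2 | (N1 <= j)%N) x 0 j * y 0 j.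

Definition dual_code (N1 N2 : nat) (C : {set word N1 N2}) : {set word N1 N2} :=
  [set y | [forall c in C, beta c y == 0]].

Definition self_dual (N1 N2 : nat) (C : {set word N1 N2}) : Prop :=
  C = dual_code C.

Definition wt (N1 N2 : nat) (c : word N1 N2) : int :=
  (\sum_(j < N1 + N2 | (j < N1)%N) (val (c 0 j))%:Z)
  - (\sum_(j < N1 + N2 | (N1 <= j)%N) (val (c 0 j))%:Z).

Definition doubly_even (N1 N2 : nat) (C : {set word N1 N2}) : Prop :=
  forall c, c \in C -> (4 %| wt c)%Z.

Definition DE_SD_code (N1 N2 : nat) (C : {set word N1 N2}) : Prop :=
  [/\ is_code C, self_dual C & doubly_even C].

Definition block_perm (N1 N2 : nat) (s : 'S_(N1 + N2)) : Prop :=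
  forall j : 'I_(N1 + N2), ((s j < N1)%N = (j < N1)%N).

Definition permute_word (N1 N2 : nat) (s : 'S_(N1 + N2)) (c : word N1 N2)
  : word N1 N2 := \row_j c 0 (s j).

Definition code_equiv (N1 N2 : nat) (C D : {set word N1 N2}) : Prop :=
  exists s : 'S_(N1 + N2), block_perm s /\ D = [set permute_word s c | c in C].

Definition Fvec (m : nat) := 'cV['F_2]_m.

(* The variables: inl f stands for x_f, inr f for xbar_f. *)
Definition nvars (m : nat) : nat := #|{: Fvec m + Fvec m}|.

Definition cpoly (K : numClosedFieldType) (m : nat) := {mpoly K[nvars m]}.

Definition xv (K : numClosedFieldType) (m : nat) (f : Fvec m) : cpoly K m :=
  'X_(enum_rank (inl f : Fvec m + Fvec m)).
Definition xbv (K : numClosedFieldType) (m : nat) (f : Fvec m) : cpoly K m :=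
  'X_(enum_rank (inr f : Fvec m + Fvec m)).

Definition bihomog (K : numClosedFieldType) (m N1 N2 : nat) (p : cpoly K m)
  : Prop :=
  forall mon, mon \in msupp p ->
    (\sum_(f : Fvec m) mon (enum_rank (inl f : Fvec m + Fvec m)) = N1)%N /\
    (\sum_(f : Fvec m) mon (enum_rank (inr f : Fvec m + Fvec m)) = N2)%N.

Definition Dim (m : nat) : nat := #|{: Fvec m}|.

Definition ent (K : numClosedFieldType) (m : nat) (g : 'M[K]_(Dim m))
  (w v : Fvec m) : K := g (enum_rank w) (enum_rank v).

Definition mxF (K : numClosedFieldType) (m : nat) (F : Fvec m -> Fvec m -> K)
  : 'M[K]_(Dim m) := \matrix_(i, j) F (enum_val i) (enum_val j).

Definition subst_var (K : numClosedFieldType) (m : nat) (g : 'M[K]_(Dim m))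
  (i : 'I_(nvars m)) : cpoly K m :=
  match enum_val i with
  | inl v => \sum_(w : Fvec m) ent g w v *: xv K w
  | inr v => \sum_(w : Fvec m) (ent g w v)^* *: xbv K w
  end.

Definition act (K : numClosedFieldType) (m : nat) (g : 'M[K]_(Dim m))
  (p : cpoly K m) : cpoly K m :=
  p \mPo [tuple subst_var g i | i < nvars m].

Definition quad (m : nat) (S : 'M[int]_m) (v : Fvec m) : int :=
  \sum_(j < m) \sum_(k < m) (val (v j 0))%:Z * S j k * (val (v k 0))%:Z.

Definition d_gen (K : numClosedFieldType) (m : nat) (S : 'M[int]_m)
  : 'M[K]_(Dim m) :=
  mxF (fun w v => if w == v then 'i ^ (quad S v) else 0).

Definition m_gen (K : numClosedFieldType) (m : nat) (g : 'M['F_2]_m)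
  (v' : Fvec m) : 'M[K]_(Dim m) :=
  mxF (fun w v => if w == g *m v + v' then 1 else 0).

(* h (x) I_2 (x) ... (x) I_2, h = 1/sqrt2 [[1,1],[1,-1]], acting on the
   tensor factor of coordinate 0 of F_2^m (requires m >= 1). *)
Definition h_gen (K : numClosedFieldType) (m : nat) : 'M[K]_(Dim m) :=
  mxF (fun w v =>
    if [forall j : 'I_m, (val j != 0%N) ==> (w j 0 == v j 0)] then
      (sqrtC 2)^-1 *
      (-1) ^+ [exists j : 'I_m, [&& val j == 0%N, w j 0 == 1 & v j 0 == 1]]
    else 0).

Inductive clifford (K : numClosedFieldType) (m : nat) : 'M[K]_(Dim m) -> Prop :=
  | cl_d (S : 'M[int]_m) : S^T = S -> clifford (d_gen K S)
  | cl_m (g : 'M['F_2]_m) (v' : Fvec m) : g \in unitmx -> clifford (m_gen K g v')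
  | cl_h : clifford (h_gen K m)
  | cl_one : clifford 1%:M
  | cl_mul a b : clifford a -> clifford b -> clifford (a *m b)
  | cl_inv a : clifford a -> clifford (invmx a).

Definition clifford_invariant (K : numClosedFieldType) (m : nat) (p : cpoly K m)
  : Prop := forall g, clifford g -> act g p = p.

Definition nu (K : numClosedFieldType) (m N1 N2 : nat)
  (M : 'M['F_2]_(m, N1 + N2)) : cpoly K m :=
  (\prod_(j < N1 + N2 | (j < N1)%N) xv K (col j M))
  * (\prod_(j < N1 + N2 | (N1 <= j)%N) xbv K (col j M)).

Definition ccwe (K : numClosedFieldType) (m N1 N2 : nat)
  (C : {set word N1 N2}) : cpoly K m :=
  \sum_(M : 'M['F_2]_(m, N1 + N2) | [forall i : 'I_m, row i M \in C]) nu K M.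

(* Main.v *)
(* An element of degree (N1,N2) is written as sum_M t(M) nu_M with t a function on
   m x (N1+N2) matrices over F_2.  On such functions d_S multiplies by a power of i,
   m_{g,v} acts by M |-> gM + v.1, and the Hadamard generator is a Fourier transform in
   the first row.
   Averaging over the subgroup generated by the d_S and m_{g,v} shows that an invariant is
   a combination of the indicators of C^m, where C runs over the doubly-even (hence
   self-orthogonal) codes containing the all-one word.  Fourier transform, restriction to
   matrices with doubly-even first row, and averaging over GL_m fix every invariant, and
   map the indicator of C^m to
     lam_C [C^m] + mu_C sum_w [<C,w>^m],  w in C^perp \ C doubly-even,
   where lam_C <= |C| / 2^(N/2) < 1 unless C is self-dual.  This triangularity eliminates
   every code that is not self-dual.
   Linear independence: if N/2 <= m+1, a self-dual code D is generated by the all-one word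
   and the rows of some M, and among inequivalent codes only D contributes to the
   coefficient of nu_M. *)
From HB Require Import structures.
From mathcomp Require Import all_boot all_order all_algebra all_fingroup.
From mathcomp Require Import mpoly ring zify.
(* Loaded last: mathcomp's [action] also defines [act]. *)
Require Import Defs.
Set Implicit Arguments. Unset Strict Implicit. Unset Printing Implicit Defensive.
Import Order.TTheory GRing.Theory Num.Theory.
Local Open Scope ring_scope.

(** * Elementary facts over the field of two elements *)

Lemma F2_eq0or1 (a : 'F_2) : (a = 0) \/ (a = 1).
Proof. by case: a => [[|[|]]] //= h; [left|right]; apply: val_inj. Qed.

Lemma F2_addrr (V : lmodType 'F_2) (x : V) : x + x = 0.
Proof. by rewrite -mulr2n -scaler_nat (_ : 2%:R = 0) ?scale0r //; apply: val_inj. Qed.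

(** * Substitution on variables and on the monomials nu_M *)

Section Action.
Variables (K : numClosedFieldType) (m N1 N2 : nat).
Local Notation mat := 'M['F_2]_(m, N1 + N2).

Definition block_var (j : 'I_(N1 + N2)) (f : Fvec m) : Fvec m + Fvec m :=
  if (j < N1)%N then inl f else inr f.

Definition block_conj (j : 'I_(N1 + N2)) (x : K) : K :=
  if (j < N1)%N then x else x^*.

(** Conjugation inverts powers of i, so the second block enters exponents of i, and hence weights,
    with sign -1. *)
Definition sgn (j : 'I_(N1 + N2)) : int := if (j < N1)%N then 1 else -1.

Definition var (j : 'I_(N1 + N2)) (f : Fvec m) : cpoly K m :=
  'X_(enum_rank (block_var j f)).

Lemma nuE (M : mat) : nu K M = \prod_j var j (col j M).
Proof.
rewrite /nu [RHS](bigID (fun j : 'I__ => (j < N1)%N)) /=.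
rewrite (eq_bigr (fun j => var j (col j M))); last first.
  by move=> j jN1; rewrite /var /block_var jN1.
rewrite [X in _ * X = _](eq_big (fun j : 'I__ => ~~ (j < N1)%N)
  (fun j => var j (col j M))) // => j; first by rewrite leqNgt.
by rewrite leqNgt => /negbTE jN1; rewrite /var /block_var jN1.
Qed.

Lemma actM (g : 'M[K]_(Dim m)) p q : act g (p * q) = act g p * act g q.
Proof. exact: rmorphM. Qed.

Lemma act_sum (g : 'M[K]_(Dim m)) (I : Type) (r : seq I) (P : pred I)
  (F : I -> cpoly K m) :
  act g (\sum_(i <- r | P i) F i) = \sum_(i <- r | P i) act g (F i).
Proof. exact: raddf_sum. Qed.

Lemma act_prod (g : 'M[K]_(Dim m)) (I : Type) (r : seq I) (P : pred I)
  (F : I -> cpoly K m) :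
  act g (\prod_(i <- r | P i) F i) = \prod_(i <- r | P i) act g (F i).
Proof. exact: rmorph_prod. Qed.

Lemma actZ (g : 'M[K]_(Dim m)) c p : act g (c *: p) = c *: act g p.
Proof. exact: linearZ. Qed.

Lemma actX (g : 'M[K]_(Dim m)) i : act g 'X_i = subst_var g i.
Proof. by rewrite /act comp_mpolyXU -tnth_nth tnth_mktuple. Qed.

Lemma act_var (g : 'M[K]_(Dim m)) j f :
  act g (var j f) = \sum_w block_conj j (ent g w f) *: var j w.
Proof.
rewrite /var actX /subst_var enum_rankK /block_var /block_conj.
by case: (j < N1)%N.
Qed.

End Action.

(** * Substitution as a left action of matrices *)

Section ActionMonoid.
Variables (K : numClosedFieldType) (m : nat).
Implicit Types (g : 'M[K]_(Dim m)) (p : cpoly K m).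

Lemma act1 p : act 1%:M p = p.
Proof.
rewrite -[RHS]comp_mpoly_id /act; congr (_ \mPo _).
apply: eq_from_tnth => i; rewrite !tnth_mktuple /subst_var.
have ent1 (w v : Fvec m) : ent 1%:M w v = (w == v)%:R :> K.
  by rewrite /ent mxE (inj_eq enum_rank_inj).
by case Ei: (enum_val i) => [v|v]; rewrite (bigD1 v) //= big1 => [|w /negbTE wv];
  rewrite ent1 ?wv ?eqxx ?conjC0 ?scale0r ?conjC1 ?scale1r ?addr0 /xv /xbv -?Ei ?enum_valK.
Qed.

(** Both sides are algebra morphisms in p, so comparing them on the variables suffices; since x_v is
    replaced using column v of the matrix, the order of the factors is preserved. *)
Lemma act_mul a b p : act (a *m b) p = act a (act b p).
Proof.
have actX_mul i : act (a *m b) 'X_i = act a (act b 'X_i).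
  have ent_mul (w v : Fvec m) : ent (a *m b) w v = \sum_u ent a w u * ent b u v.
    rewrite /ent mxE (reindex (@enum_rank (Fvec m))) //=.
    by exists enum_val => u _; rewrite ?enum_valK ?enum_rankK.
  rewrite !actX /subst_var; case: (enum_val i) => v;
    rewrite act_sum /=; under [RHS]eq_bigr => u _
      do rewrite actZ /xv /xbv actX /subst_var enum_rankK scaler_sumr;
    rewrite exchange_big /=; apply: eq_bigr => w _; rewrite ent_mul ?raddf_sum /=
      scaler_suml; apply: eq_bigr => u _; by rewrite scalerA ?rmorphM mulrC.
rewrite [p]mpolyE [act (a *m b) _]act_sum [act b _]act_sum [act a _]act_sum.
apply: eq_bigr => mon _.
rewrite [act (a *m b) _]actZ [act b _]actZ [act a _]actZ; congr (_ *: _).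
rewrite mpolyXE_id [act (a *m b) _]act_prod [act b _]act_prod [act a _]act_prod.
apply: eq_bigr => i _; elim: (mon i) => [|k IHk].
  by rewrite !expr0 [RHS]/act [in X in X \mPo _]/act !comp_mpoly1 /act comp_mpoly1.
by rewrite !exprS [LHS]actM IHk actX_mul [act b (_ * _)]actM [RHS]actM.
Qed.

Lemma invariant_of_generators p :
  (forall S : 'M[int]_m, S^T = S -> act (d_gen K S) p = p) ->
  (forall (g : 'M['F_2]_m) v, g \in unitmx -> act (m_gen K g v) p = p) ->
  act (h_gen K m) p = p -> clifford_invariant p.
Proof.
move=> pd pm ph g; elim=> {g} [S||||a b _ pa _ pb|a _ pa]; [exact: pd|exact: pm|exact: ph| | |].
- exact: act1.
- by rewrite act_mul pb.
(* [invmx] returns a singular matrix unchanged, so in that case the claim is the induction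
   hypothesis itself. *)
- have [ua|/negbTE nua] := boolP (a \in unitmx); last by rewrite /invmx nua.
  by rewrite -{1}pa -act_mul mulVmx // act1.
Qed.

End ActionMonoid.

(** * The diagonal and affine generators on monomials *)

Section Generators.
Variables (K : numClosedFieldType) (m N1 N2 : nat).
Local Notation mat := 'M['F_2]_(m, N1 + N2).

Definition ones : word N1 N2 := const_mx 1.

(** Each column f becomes g f + v. Adding v to every column adds multiples of the all-one word to
    the rows, which is why the codes below must contain that word. *)
Definition affine (g : 'M['F_2]_m) (v : Fvec m) (M : mat) : mat :=
  g *m M + v *m ones.

Lemma act_nu (g : 'M[K]_(Dim m)) (M : mat) :
  act g (nu K M) = \prod_j \sum_w block_conj j (ent g w (col j M)) *: var K j w.
Proof. by rewrite nuE act_prod; apply: eq_bigr => j _; rewrite act_var. Qed.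

Lemma mxFE (F : Fvec m -> Fvec m -> K) w v : ent (mxF F) w v = F w v.
Proof. by rewrite /ent /mxF mxE !enum_rankK. Qed.

Lemma block_conj0 (j : 'I_(N1 + N2)) : block_conj j 0 = 0 :> K.
Proof. by rewrite /block_conj conjC0 if_same. Qed.

Lemma block_conj1 (j : 'I_(N1 + N2)) : block_conj j 1 = 1 :> K.
Proof. by rewrite /block_conj conjC1 if_same. Qed.

Lemma expiD (y z : int) : 'i ^ (y + z) = 'i ^ y * 'i ^ z :> K.
Proof. by rewrite exprzDr // unitfE neq0Ci. Qed.

Lemma block_conj_expi (j : 'I_(N1 + N2)) (z : int) :
  block_conj j ('i ^ z) = 'i ^ (sgn j * z) :> K.
Proof.
rewrite /block_conj /sgn; case: ifP => _; first by rewrite mul1r.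
by rewrite mulN1r rmorphXz ?unitfE ?neq0Ci //= conjCi -invCi -exprz_inv.
Qed.

Definition quadM (S : 'M[int]_m) (M : mat) : int :=
  \sum_j sgn j * quad S (col j M).

Lemma act_d_nu (S : 'M[int]_m) (M : mat) :
  act (d_gen K S) (nu K M) = 'i ^ quadM S M *: nu K M.
Proof.
rewrite act_nu nuE /quadM.
rewrite (big_morph (fun z => 'i ^ z) expiD (erefl : 'i ^ 0 = 1 :> K)).
rewrite -scaler_prod; apply: eq_bigr => j _.
rewrite (bigD1 (col j M)) //= big1 ?addr0 => [|w /negbTE wv].
  by rewrite mxFE eqxx block_conj_expi.
by rewrite mxFE wv block_conj0 scale0r.
Qed.

Lemma act_m_nu (g : 'M['F_2]_m) v (M : mat) :
  act (m_gen K g v) (nu K M) = nu K (affine g v M).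
Proof.
rewrite act_nu nuE; apply: eq_bigr => j _.
have -> : col j (affine g v M) = g *m col j M + v.
  rewrite /affine; apply/matrixP => i k; rewrite !mxE; congr (_ + _).
    by apply: eq_bigr => l _; rewrite !mxE.
  by rewrite big_ord1 !mxE mulr1 (ord1 k).
rewrite (bigD1 (g *m col j M + v)) //= big1 ?addr0 => [|w /negbTE wv].
  by rewrite mxFE eqxx block_conj1 scale1r.
by rewrite mxFE wv block_conj0 scale0r.
Qed.

End Generators.

(** * The Hadamard generator on monomials *)

Section Hadamard.
Variables (K : numClosedFieldType) (m N1 N2 : nat).
Local Notation mat := 'M['F_2]_(m.+1, N1 + N2).

Definition chi (a : 'F_2) : K := (-1) ^+ (a == 1).

Lemma chi0 : chi 0 = 1. Proof. by []. Qed.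

Lemma chiD a b : chi (a + b) = chi a * chi b.
Proof.
by case: (F2_eq0or1 a) => ->; case: (F2_eq0or1 b) => ->;
  rewrite /chi /= ?mulrNN ?mulr1 ?mul1r.
Qed.

Definition dot (x y : word N1 N2) : 'F_2 := \sum_j x 0 j * y 0 j.

Definition set_row0 (w : word N1 N2) (M : mat) : mat :=
  \matrix_(i, j) if i == 0 then w 0 j else M i j.

Definition set_coord0 (a : 'F_2) (v : Fvec m.+1) : Fvec m.+1 :=
  \col_i if i == 0 then a else v i 0.

Lemma ent_h (w v : Fvec m.+1) :
  ent (h_gen K m.+1) w v =
    if w == set_coord0 (w 0 0) v then (sqrtC 2)^-1 * chi (w 0 0 * v 0 0) else 0.
Proof.
rewrite mxFE; have -> : [forall j : 'I_m.+1, (val j != 0%N) ==> (w j 0 == v j 0)]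
    = (w == set_coord0 (w 0 0) v).
  apply/forallP/eqP => [wv|-> j].
    2: by rewrite !mxE; case: (j =P 0) => [->|_] //=; rewrite eqxx implybT.
  apply/colP => j; rewrite mxE; case: (j =P 0) => [->|/eqP j0] //.
  by have /implyP/(_ j0)/eqP := wv j.
case: ifP => // _; congr (_ * _); rewrite /chi; congr (_ ^+ nat_of_bool _).
apply/existsP/idP => [[j /and3P[/eqP j0 wj vj]]|].
  have -> : 0 = j by apply: val_inj.
  by rewrite (eqP wj) (eqP vj).
move=> wv; exists 0; rewrite /=.
by case: (F2_eq0or1 (w 0 0)) wv => ->; case: (F2_eq0or1 (v 0 0)) => ->.
Qed.

Lemma conj_sqrtC2V : ((sqrtC 2)^-1)^* = (sqrtC 2)^-1 :> K.
Proof. by apply/CrealP; rewrite realV ger0_real // sqrtC_ge0 ler0n. Qed.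

Lemma conj_chi a : (chi a)^* = chi a.
Proof. by rewrite /chi rmorphXn /= rmorphN rmorph1. Qed.

(** The matrix h is real, so both blocks transform alike. *)
Lemma act_h_var (j : 'I_(N1 + N2)) v :
  act (h_gen K m.+1) (var K j v) =
    \sum_(a : 'F_2) ((sqrtC 2)^-1 * chi (a * v 0 0)) *: var K j (set_coord0 a v).
Proof.
rewrite act_var (partition_big (fun w : Fvec m.+1 => w 0 0) predT) //=.
apply: eq_bigr => a _; rewrite (bigD1 (set_coord0 a v)) /=; last by rewrite mxE.
rewrite big1 ?addr0 => [|w /andP[/eqP wa /negbTE wv]]; last first.
  by rewrite ent_h wa wv block_conj0 scale0r.
rewrite ent_h [set_coord0 a v 0 0]mxE !eqxx /block_conj.
by rewrite rmorphM /= conj_chi conj_sqrtC2V if_same.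
Qed.

(** Each column chooses its new first entry independently. Expanding the product collects the
    choices into a word w, the new first row, and the signs into one character value. *)
Lemma act_h_nu (M : mat) :
  act (h_gen K m.+1) (nu K M) =
    \sum_w ((sqrtC 2) ^- (N1 + N2) * chi (dot w (row 0 M))) *: nu K (set_row0 w M).
Proof.
rewrite nuE act_prod.
under eq_bigr => j _ do rewrite act_h_var.
rewrite bigA_distr_bigA /=.
rewrite (reindex (fun w : word N1 N2 => [ffun j => w 0 j])) /=; last first.
  exists (fun f : {ffun 'I_(N1 + N2) -> 'F_2} => \row_j f j) => [w _|f _].
    by apply/rowP => j; rewrite mxE ffunE.
  by apply/ffunP => j; rewrite ffunE mxE.
apply: eq_bigr => w _; rewrite scaler_prod nuE; congr (_ *: _).
  rewrite big_split prodr_const card_ord exprVn /=; congr (_ * _).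
  rewrite /dot (big_morph chi chiD chi0).
  by apply: eq_bigr => j _; rewrite ffunE !mxE.
apply: eq_bigr => j _; congr (var _ _ _).
by apply/colP => i; rewrite !mxE ffunE.
Qed.

End Hadamard.

(** * Binary codes, weights and duality *)

Section Codes.
Variables (N1 N2 : nat).
Local Notation word := (word N1 N2).
Implicit Types (x y w : word) (C D : {set word}).

Lemma betaE x y : beta x y = dot x y.
Proof.
rewrite /beta /dot [RHS](bigID (fun j : 'I__ => (j < N1)%N)) /= -sumrN; congr (_ + _).
apply: eq_big => j; first by rewrite -leqNgt.
by move=> _; case: (F2_eq0or1 (x 0 j * y 0 j)) => ->; apply: val_inj.
Qed.

(** An integral lift of [dot], signed so that its diagonal is the weight. *)
Definition zdot x y : int := \sum_j sgn j * ((val (x 0 j))%:Z * (val (y 0 j))%:Z).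

Lemma wtE x : wt x = \sum_j sgn j * (val (x 0 j))%:Z.
Proof.
rewrite /wt [RHS](bigID (fun j : 'I__ => (j < N1)%N)) /= -sumrN; congr (_ + _).
  by apply: eq_bigr => j jN1; rewrite /sgn jN1 mul1r.
apply: eq_big => j; first by rewrite -leqNgt.
by rewrite leqNgt /sgn => /negbTE ->; rewrite mulN1r.
Qed.

Lemma zdotxx x : zdot x x = wt x.
Proof.
rewrite wtE; apply: eq_bigr => j _; congr (_ * _).
by case: (F2_eq0or1 (x 0 j)) => ->.
Qed.

Lemma zdotx1 x : zdot x (ones N1 N2) = wt x.
Proof. by rewrite wtE; apply: eq_bigr => j _; rewrite mxE /= mulr1. Qed.

Lemma zdotC x y : zdot x y = zdot y x.
Proof. by apply: eq_bigr => j _; rewrite [X in _ * X]mulrC. Qed.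

Lemma wtD x y : wt (x + y) = wt x + wt y - 2 * zdot x y.
Proof.
rewrite !wtE mulr_sumr -sumrN -!big_split /=; apply: eq_bigr => j _; rewrite mxE.
by case: (F2_eq0or1 (x 0 j)) => ->; case: (F2_eq0or1 (y 0 j)) => ->;
  rewrite /sgn; case: (j < N1)%N.
Qed.

Lemma F2_intr_eq0 (z : int) : (z%:~R == 0 :> 'F_2) = (2 %| z)%Z.
Proof. by rewrite (dvdz_pcharf (pchar_Fp _)). Qed.

Lemma dot_eq0 x y : (dot x y == 0) = (2 %| zdot x y)%Z.
Proof.
rewrite -F2_intr_eq0; congr (_ == _); rewrite /dot /zdot raddf_sum /=.
apply: eq_bigr => j _; rewrite /sgn; case: (F2_eq0or1 (x 0 j)) => ->;
  case: (F2_eq0or1 (y 0 j)) => ->; case: (j < N1)%N; exact: val_inj.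
Qed.

Lemma dotC x y : dot x y = dot y x.
Proof. by apply: eq_bigr => j _; rewrite mulrC. Qed.

Lemma dotDl x y w : dot (x + y) w = dot x w + dot y w.
Proof. by rewrite /dot -big_split; apply: eq_bigr => j _; rewrite mxE mulrDl. Qed.

Lemma dotDr x y w : dot w (x + y) = dot w x + dot w y.
Proof. by rewrite !(dotC w) dotDl. Qed.

(** The cross term 2 [zdot x y] of [wtD] is divisible by 4 exactly when [zdot x y] is even. This
    links doubly-evenness to self-orthogonality. *)
Lemma dvd4_wtD x y : (4 %| wt x)%Z -> (4 %| wt y)%Z ->
  (4 %| wt (x + y))%Z = (dot x y == 0).
Proof. by rewrite dot_eq0 wtD; lia. Qed.

Lemma dvd4_dot1 x : (4 %| wt x)%Z -> dot x (ones N1 N2) = 0.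
Proof. by move=> x4; apply/eqP; rewrite dot_eq0 zdotx1; lia. Qed.

Lemma dvd4_ones x : (4 %| wt x)%Z -> (4 %| wt (x + ones N1 N2))%Z ->
  (4 %| wt (ones N1 N2))%Z.
Proof. by rewrite wtD zdotx1; lia. Qed.

Definition codeb C := (0 \in C) && [forall x in C, forall y in C, x + y \in C].

Definition admissible C :=
  [&& codeb C, [forall c in C, (4 %| wt c)%Z] & ones N1 N2 \in C].

Lemma codebP C : reflect (is_code C) (codeb C).
Proof.
apply: (iffP andP) => [[C0 /forall_inP CD]|[C0 CD _]]; split=> //.
- by move=> x y /CD/forall_inP; apply.
- by move=> a x xC; case: (F2_eq0or1 a) => ->; rewrite ?scale0r ?scale1r.
- by apply/forall_inP => x xC; apply/forall_inP => y; apply: CD.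
Qed.

Lemma mem_dual C x : (x \in dual_code C) = [forall c in C, dot c x == 0].
Proof. by rewrite inE; apply: eq_forallb => c; rewrite betaE. Qed.

Lemma code0 C : is_code C -> 0 \in C. Proof. by case. Qed.

Lemma codeD C x y : is_code C -> x \in C -> y \in C -> x + y \in C.
Proof. by case=> _ CD _; apply: CD. Qed.

Lemma codeDl C x y : is_code C -> x \in C -> (x + y \in C) = (y \in C).
Proof.
move=> cC xC; apply/idP/idP => [xy|]; last exact: codeD.
by rewrite -[y]add0r -(F2_addrr x) -addrA codeD.
Qed.

Lemma code_sum C (I : finType) (F : I -> word) :
  is_code C -> (forall i, F i \in C) -> \sum_i F i \in C.
Proof.
move=> cC FC; apply: (big_ind (fun x => x \in C)) => [|x y|i _]; [exact: code0|exact: codeD|exact: FC].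
Qed.

Lemma codeZ C a x : is_code C -> x \in C -> a *: x \in C.
Proof. by case=> _ _; apply. Qed.

Lemma dual_is_code C : is_code (dual_code C).
Proof.
apply/codebP; rewrite /codeb mem_dual; apply/andP; split.
  by apply/forall_inP => c _; rewrite /dot big1 // => j _; rewrite mxE mulr0.
apply/forall_inP => x; rewrite mem_dual => /forall_inP Cx.
apply/forall_inP => y; rewrite !mem_dual => /forall_inP Cy.
by apply/forall_inP => c cC; rewrite dotDr (eqP (Cx c cC)) (eqP (Cy c cC)) addr0.
Qed.

Lemma admissible_code C : admissible C -> is_code C.
Proof. by case/and3P => /codebP. Qed.

Lemma admissible_wt C x : admissible C -> x \in C -> (4 %| wt x)%Z.
Proof. by case/and3P => _ /forall_inP C4 _; apply: C4. Qed.

Lemma admissible_ones C : admissible C -> ones N1 N2 \in C.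
Proof. by case/and3P. Qed.

Lemma admissible_dual C : admissible C -> C \subset dual_code C.
Proof.
move=> aC; apply/subsetP => x xC; rewrite mem_dual; apply/forall_inP => c cC.
by rewrite -dvd4_wtD ?(admissible_wt aC) // codeD //; apply: admissible_code.
Qed.

(** The product of a word with the all-one word is its weight mod 2, so a doubly-even self-dual code
    contains the all-one word. *)
Lemma DE_SD_admissible C :
  DE_SD_code C <-> admissible C && (dual_code C == C).
Proof.
split=> [[cC sC dC]|/andP[aC /eqP sC]]; last first.
  by split=> //; [apply: admissible_code|move=> c; apply: admissible_wt].
rewrite -sC eqxx andbT; apply/and3P; split; first exact/codebP.
  by apply/forall_inP.
by rewrite sC mem_dual; apply/forall_inP => c /dC c4; rewrite dvd4_dot1.
Qed.

(** For a code C this is the span of C and w: over F_2 it consists of C and the coset w + C. *)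
Definition extend C w : {set word} := [set x | (x \in C) || (w + x \in C)].

Lemma sub_extend C w : C \subset extend C w.
Proof. by apply/subsetP => x xC; rewrite inE xC. Qed.

Lemma mem_extend C w : is_code C -> w \in extend C w.
Proof. by move=> cC; rewrite inE F2_addrr code0 ?orbT. Qed.

Lemma extend_proper C w : is_code C -> w \notin C -> C \proper extend C w.
Proof.
move=> cC wC; rewrite properE sub_extend; apply/subsetPn; exists w => //.
exact: mem_extend.
Qed.

Lemma extend_code C w : is_code C -> is_code (extend C w).
Proof.
move=> cC; apply/codebP; rewrite /codeb inE code0 //=.
apply/forall_inP => x; rewrite inE => xC; apply/forall_inP => y; rewrite !inE => yC.
case/orP: xC => xC; case/orP: yC => yC.
- by rewrite (codeD cC xC yC).
- by rewrite addrCA (codeD cC xC yC) orbT.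
- by rewrite addrA (codeD cC xC yC) orbT.
- apply/orP; left; rewrite -[x + y]add0r -(F2_addrr w) addrACA.
  exact: codeD.
Qed.

Lemma extend_admissible C w : admissible C -> w \in dual_code C ->
  (4 %| wt w)%Z -> admissible (extend C w).
Proof.
move=> aC; rewrite mem_dual => /forall_inP Cw w4; have cC := admissible_code aC.
apply/and3P; split; first exact/codebP/extend_code.
  apply/forall_inP => x; rewrite inE => /orP[|wx]; first exact: admissible_wt.
  have -> : x = (w + x) + w by rewrite addrAC F2_addrr add0r.
  by rewrite dvd4_wtD ?Cw // (admissible_wt aC).
by rewrite inE admissible_ones.
Qed.

Lemma card_extend C w : is_code C -> w \notin C -> #|extend C w| = (2 * #|C|)%N.
Proof.
move=> cC wC; have -> : extend C w = C :|: [set w + x | x in C].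
  apply/setP => x; rewrite !inE; congr (_ || _); apply/idP/imsetP => [wx|[y yC ->]].
    by exists (w + x) => //; rewrite addrA F2_addrr add0r.
  by rewrite addrA F2_addrr add0r.
rewrite cardsU (_ : _ :&: _ = set0) ?cards0 ?subn0.
  by rewrite card_imset ?mul2n ?addnn //; apply: addrI.
apply/setP => x; rewrite !inE; apply/negP => /andP[xC /imsetP[y yC xE]].
by move: xC; rewrite xE addrC codeDl // (negbTE wC).
Qed.

(** * Character sums and the size of the dual code *)

Section Fourier.
Variable K : numClosedFieldType.

(** Orthogonality of characters: if some d in C is not orthogonal to w, translating the sum by d
    changes its sign, so it vanishes. *)
Lemma sum_chi_code C w : is_code C ->
  \sum_(c in C) chi K (dot c w) = (#|C| * (w \in dual_code C))%:R.
Proof.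
move=> cC; have [|] := boolP (w \in _).
  rewrite mem_dual => /forall_inP Cw; rewrite muln1 -sumr_const.
  by apply: eq_bigr => c /Cw/eqP ->.
rewrite mem_dual negb_forall_in => /exists_inP[d dC dw]; rewrite muln0.
have chid : chi K (dot d w) = -1.
  by case: (F2_eq0or1 (dot d w)) dw => -> //; rewrite eqxx.
set s := \sum_(_ in _) _; suff: s = - s.
  by move/eqP; rewrite -addr_eq0 -mulr2n mulrn_eq0 => /eqP.
rewrite {1}/s (reindex_inj (addrI d)) /=.
rewrite (eq_bigl (mem C)) => [|c]; last by rewrite /= codeDl.
by rewrite -mulN1r -chid mulr_sumr; apply: eq_bigr => c _; rewrite dotDl chiD.
Qed.

(** The sum of chi(dot c w) over c in C and all words w is evaluated in both orders: summing over c
    first leaves the w in the dual, summing over w first leaves only c = 0. *)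
Lemma card_dual C : is_code C -> (#|C| * #|dual_code C|)%N = (2 ^ (N1 + N2))%N.
Proof.
move=> cC; apply/eqP; rewrite -(eqr_nat K); apply/eqP.
have -> : (#|C| * #|dual_code C|)%:R = \sum_w \sum_(c in C) chi K (dot c w).
  under eq_bigr => w _ do rewrite sum_chi_code // natrM.
  rewrite -mulr_sumr -natr_sum natrM; congr (_ * _%:R).
  by rewrite -sum1_card big_mkcond; apply: eq_bigr => w _; case: (w \in _).
have cT : is_code [set: word] by split=> *; rewrite inE.
rewrite exchange_big (bigD1 0) /=; last exact: code0.
rewrite [X in _ + X]big1 ?addr0.
  under eq_bigr => w _.
    rewrite (_ : dot 0 w = 0) ?chi0; first over.
    by rewrite /dot big1 // => j _; rewrite mxE mul0r.
  by rewrite sumr_const card_mx card_Fp // mul1n.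
move=> c /andP[_ c0]; under eq_bigr => w _ do rewrite dotC.
transitivity (\sum_(w in [set: word]) chi K (dot w c)).
  by apply: eq_bigl => w; rewrite inE.
rewrite sum_chi_code //.
suff -> : c \in dual_code setT = false by rewrite muln0.
apply: contraNF c0; rewrite mem_dual => /forall_inP c0; apply/eqP/rowP => j.
have /eqP := c0 (delta_mx 0 j) (in_setT _); rewrite /dot (bigD1 j) //= big1 ?addr0.
  by rewrite !mxE !eqxx mul1r.
by move=> k /negbTE kj; rewrite !mxE kj andbF mul0r.
Qed.

End Fourier.
End Codes.

(** * Matrices whose rows lie in a code *)

Section CodeMatrices.
Variables (m N1 N2 : nat).
Local Notation mat := 'M['F_2]_(m, N1 + N2).
Implicit Types (C : {set word N1 N2}) (M : mat).

Definition over C M := [forall i, row i M \in C].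

Lemma over_affine C g v M : is_code C -> ones N1 N2 \in C ->
  over C M -> over C (affine g v M).
Proof.
move=> cC C1 /forallP CM; apply/forallP => i.
have -> : row i (affine g v M) = (\sum_k g i k *: row k M) + v i 0 *: ones N1 N2.
  apply/rowP => j; rewrite !mxE summxE; congr (_ + _).
    by apply: eq_bigr => k _; rewrite !mxE.
  by rewrite big_ord1 !mxE.
apply: codeD => //; last exact: codeZ.
by apply: code_sum => // k; apply: codeZ.
Qed.

Lemma quadME S M :
  quadM S M = \sum_a \sum_b S a b * zdot (row a M) (row b M).
Proof.
rewrite /quadM /quad; under eq_bigr => j _ do rewrite mulr_sumr.
rewrite exchange_big; apply: eq_bigr => a _ /=.
under eq_bigr => j _ do rewrite mulr_sumr.
rewrite exchange_big; apply: eq_bigr => b _ /=.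
by rewrite mulr_sumr; apply: eq_bigr => j _; rewrite !mxE; ring.
Qed.

(** Off-diagonal terms occur in equal pairs of even numbers. The induction splits off the first row
    and column. *)
Lemma dvd4_sym_sum n (T : 'I_n -> 'I_n -> int) :
  (forall a b, T a b = T b a) -> (forall a, (4 %| T a a)%Z) ->
  (forall a b, (2 %| T a b)%Z) -> (4 %| \sum_a \sum_b T a b)%Z.
Proof.
elim: n T => [|n IHn] T Tsym T4 T2; first by rewrite big_ord0.
have IH : (4 %| \sum_a \sum_b T (lift ord0 a) (lift ord0 b))%Z.
  by apply: IHn => [a b|a|a b]; [exact: Tsym|exact: T4|exact: T2].
have T0 : (2 %| \sum_(a < n) T ord0 (lift ord0 a))%Z.
  by apply: (big_ind (fun z => 2 %| z)%Z) => [|x y|a _]; [by []|lia|exact: T2].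
rewrite !big_ord_recl /=.
rewrite [X in _ + X](_ : _ = \sum_(a < n) T ord0 (lift ord0 a)
  + \sum_a \sum_b T (lift ord0 a) (lift ord0 b)); last first.
  rewrite -big_split; apply: eq_bigr => a _ /=; by rewrite big_ord_recl Tsym.
move: (T4 ord0) IH T0; set A := T _ _; set B := \sum_a \sum_b _; set D := \sum_a _; lia.
Qed.

(** The diagonal terms are multiples of row weights and the off-diagonal ones are even by
    self-orthogonality. Hence d_S fixes nu_M for every M over C. *)
Lemma dvd4_quadM C S M : admissible C -> S^T = S -> over C M ->
  (4 %| quadM S M)%Z.
Proof.
move=> aC ST /forallP CM; rewrite quadME; apply: dvd4_sym_sum => [a b|a|a b].
- by rewrite zdotC -[in RHS]ST mxE.
- by rewrite zdotxx dvdz_mull // (admissible_wt aC).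
- rewrite dvdz_mull // -dot_eq0.
  have /subsetP/(_ _ (CM b)) := admissible_dual aC.
  by rewrite mem_dual => /forall_inP; apply.
Qed.

End CodeMatrices.

Lemma expi_eq1 (K : numClosedFieldType) (z : int) :
  ('i ^ z == 1 :> K) = (4 %| z)%Z.
Proof.
have i2 : 'i ^ 2%:Z = -1 :> K by rewrite -exprnP sqrCi.
have i4 : 'i ^ 4%:Z = 1 :> K by rewrite (expiD _ 2 2) i2 mulrNN mulr1.
have n1 : -1 != 1 :> K by rewrite eq_sym -addr_eq0 -mulr2n pnatr_eq0.
have i1 : 'i != 1 :> K by apply: contra_neq n1 => i1; rewrite -i2 i1 exp1rz.
rewrite {1}(divz_eq z 4) expiD [(_ * 4)%R]mulrC -exprz_exp i4 exp1rz mul1r.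
have [r0|[r1|[r2|r3]]] : (z %% 4 = 0 \/ z %% 4 = 1 \/ z %% 4 = 2 \/ z %% 4 = 3)%Z by lia.
- by rewrite r0 expr0z eqxx; symmetry; lia.
- by rewrite r1 expr1z (negbTE i1); symmetry; lia.
- by rewrite r2 i2 (negbTE n1); symmetry; lia.
- rewrite r3 (expiD _ 2 1) i2 expr1z mulN1r.
  suff /negbTE -> : - 'i != 1 :> K by symmetry; lia.
  by apply: contra_neq n1 => i3; rewrite -i2 -exprnP -sqrrN i3 expr1n.
Qed.

(** * Bihomogeneous polynomials as coefficient functions on matrices *)

Section Tensor.
Variables (K : numClosedFieldType) (m N1 N2 : nat).
Local Notation mat := 'M['F_2]_(m, N1 + N2).
Implicit Types (t : mat -> K) (C : {set word N1 N2}).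

(** In general [tens] is not injective, since permuting columns within a block preserves nu_M.
    Invariance of a polynomial thus does not pass to a given t; instead t is repeatedly replaced by
    another function with the same [tens t]. *)
Definition tens t : cpoly K m := \sum_M t M *: nu K M.

Definition ind C (M : mat) : K := (over C M)%:R.

Lemma eq_tens t1 t2 : t1 =1 t2 -> tens t1 = tens t2.
Proof. by move=> t12; apply: eq_bigr => M _; rewrite t12. Qed.

Lemma tensZ c t : tens (fun M => c * t M) = c *: tens t.
Proof. by rewrite /tens scaler_sumr; apply: eq_bigr => M _; rewrite scalerA. Qed.

Lemma tensD t1 t2 : tens (fun M => t1 M + t2 M) = tens t1 + tens t2.
Proof. by rewrite /tens -big_split; apply: eq_bigr => M _; rewrite scalerDl. Qed.

Lemma tens_sum (I : Type) (r : seq I) (P : pred I) (F : I -> mat -> K) :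
  tens (fun M => \sum_(i <- r | P i) F i M) = \sum_(i <- r | P i) tens (F i).
Proof. by rewrite /tens exchange_big; apply: eq_bigr => M _; rewrite scaler_suml. Qed.

Lemma ccweE C : ccwe K m C = tens (ind C).
Proof.
rewrite /ccwe big_mkcond; apply: eq_bigr => M _; rewrite /ind /over.
by case: ifP; rewrite ?scale1r ?scale0r.
Qed.

Definition mon (M : mat) : 'X_{1..nvars m} :=
  (\sum_j U_(enum_rank (block_var j (col j M))))%MM.

Lemma nuX M : nu K M = 'X_[mon M].
Proof. rewrite nuE /mon.
by rewrite (big_morph (fun k => 'X_[k] : cpoly K m) (@mpolyXD _ _) (mpolyX0 _ _)). Qed.

Lemma mon_onto (k : 'X_{1..nvars m}) :
  (\sum_(f : Fvec m) k (enum_rank (inl f : Fvec m + Fvec m)) = N1)%N ->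
  (\sum_(f : Fvec m) k (enum_rank (inr f : Fvec m + Fvec m)) = N2)%N ->
  exists M : mat, nu K M = 'X_[k].
Proof.
move=> k1 k2.
(* [s i] lists each f as often as k prescribes, giving the columns of one block. By [k1] and [k2]
   the lengths are N1 and N2, so the default 0 of [nth] below is never reached. *)
pose s (i : Fvec m -> Fvec m + Fvec m) :=
  flatten [seq nseq (k (enum_rank (i f))) f | f <- enum {: Fvec m}].
have size_s i : size (s i) = (\sum_f k (enum_rank (i f)))%N.
  rewrite size_flatten /shape -map_comp sumnE big_map big_enum.
  by apply: eq_bigr => f _ /=; rewrite size_nseq.
have prod_s i (F : Fvec m -> cpoly K m) :
    \prod_(f <- s i) F f = \prod_f F f ^+ k (enum_rank (i f)).
  rewrite big_flatten big_map big_enum; apply: eq_bigr => f _ /=.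
  by rewrite big_nseq -Monoid.iteropE; elim: (k _) => //= n ->; rewrite exprS.
pose M : mat := \matrix_(i, j) (if (j < N1)%N then nth 0 (s inl) j
                                else nth 0 (s inr) (j - N1)) i 0.
exists M.
rewrite nuE big_split_ord /= mpolyXE_id.
rewrite (reindex (@enum_rank {: Fvec m + Fvec m})) /=; last first.
  by exists enum_val => i _; rewrite ?enum_valK ?enum_rankK.
rewrite big_sumType /=.
have E1 : \prod_(j < N1) var K (lshift N2 j) (col (lshift N2 j) M)
    = \prod_f 'X_(enum_rank (inl f)) ^+ k (enum_rank (inl f)) :> cpoly K m.
  rewrite -(prod_s inl (fun f => 'X_(enum_rank (inl f)))) (big_nth 0) size_s k1 big_mkord.
  apply: eq_bigr => j _; rewrite /var /block_var /= ltn_ord.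
  suff -> : col (lshift N2 j) M = nth 0 (s inl) j by [].
  by apply/colP => i; rewrite !mxE /= ltn_ord.
have E2 : \prod_(j < N2) var K (rshift N1 j) (col (rshift N1 j) M)
    = \prod_f 'X_(enum_rank (inr f)) ^+ k (enum_rank (inr f)) :> cpoly K m.
  rewrite -(prod_s inr (fun f => 'X_(enum_rank (inr f)))) (big_nth 0) size_s k2 big_mkord.
  apply: eq_bigr => j _; rewrite /var /block_var /= ltnNge leq_addr /=.
  suff -> : col (rshift N1 j) M = nth 0 (s inr) j by [].
  by apply/colP => i; rewrite !mxE /= ltnNge leq_addr /= addKn.
by rewrite E1 E2.
Qed.

Lemma bihomog_tens (p : cpoly K m) : bihomog N1 N2 p -> exists t, p = tens t.
Proof.
move=> hp; suff [t tE]: exists t, \sum_(k <- msupp p) p@_k *: 'X_[k] = tens t.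
  by exists t; rewrite -tE -mpolyE.
have: all (mem (msupp p)) (msupp p) by apply/allP.
elim: {2 3}(msupp p) => [_|k s IHs /= /andP[ks /IHs[t tE]]].
  by exists (fun=> 0); rewrite big_nil /tens big1 // => M _; rewrite scale0r.
have [k1 k2] := hp k ks; have [M0 M0E] := mon_onto k1 k2.
exists (fun M => p@_k * (M == M0)%:R + t M).
rewrite big_cons tE tensD tensZ; congr (_ *: _ + _).
rewrite /tens (bigD1 M0) //= eqxx scale1r big1 ?addr0 // => M /negbTE ->.
by rewrite scale0r.
Qed.

Lemma tens_bihomog t : bihomog N1 N2 (tens t).
Proof.
move=> k; rewrite mcoeff_msupp /tens raddf_sum /= => nz.
have [M _ /eqP] : exists2 M : mat, true & (t M *: nu K M)@_k != 0.
  apply/exists_inP; apply: contraNT nz; rewrite negb_exists_in => /forall_inP z.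
  by rewrite big1 // => M _; apply/eqP; have := z M isT; rewrite negbK.
rewrite mcoeffZ nuX mcoeffX; case: eqP => [<- _|_]; last by rewrite mulr0.
have mons (i : Fvec m -> Fvec m + Fvec m) (P : pred 'I_(N1 + N2)) :
    (forall j f, \sum_g (block_var j f == i g) = P j)%N ->
    (\sum_g mon M (enum_rank (i g)) = \sum_j P j)%N.
  move=> iP; under [RHS]eq_bigr => j _ do rewrite -(iP j (col j M)).
  rewrite exchange_big; apply: eq_bigr => g _; rewrite mnm_sumE.
  by apply: eq_bigr => j _; rewrite mnm1E (inj_eq enum_rank_inj).
split.
- rewrite (mons _ (fun j : 'I__ => j < N1)%N) => [|j f].
    rewrite big_split_ord /= (eq_bigr (fun=> 1%N)) => [|j _]; last by rewrite ltn_ord.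
    rewrite sum1_card card_ord big1 ?addn0 // => j _.
    by rewrite ltnNge leq_addr.
  rewrite /block_var; case: (j < N1)%N; last by rewrite big1.
  by rewrite (bigD1 f) //= eqxx big1 // => g /negbTE gf; rewrite eq_sym (inj_eq inl_inj) gf.
- rewrite (mons _ (fun j : 'I__ => ~~ (j < N1))%N) => [|j f].
    rewrite big_split_ord /= big1 => [|j _]; last by rewrite ltn_ord.
    rewrite (eq_bigr (fun=> 1%N)) ?sum1_card ?card_ord // => j _.
    by rewrite ltnNge leq_addr.
  rewrite /block_var; case: (j < N1)%N; first by rewrite big1.
  by rewrite (bigD1 f) //= eqxx big1 // => g /negbTE gf; rewrite eq_sym (inj_eq inr_inj) gf.
Qed.

End Tensor.

(** * Orbits of matrices under the affine group *)

Section Affine.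
Variables (m N1 N2 : nat).
Local Notation mat := 'M['F_2]_(m, N1 + N2).
Implicit Types (M : mat) (g : 'M['F_2]_m) (v : Fvec m).

Lemma affine_comp g v g' v' M :
  affine g v (affine g' v' M) = affine (g *m g') (g *m v' + v) M.
Proof. by rewrite /affine mulmxDr mulmxDl !mulmxA addrA. Qed.

Lemma affine1 M : affine 1%:M 0 M = M.
Proof. by rewrite /affine mul1mx mul0mx addr0. Qed.

Lemma affineK g v : g \in unitmx ->
  cancel (@affine m N1 N2 g v) (affine (invmx g) (invmx g *m v)).
Proof. by move=> gu M; rewrite affine_comp mulVmx // F2_addrr affine1. Qed.

Lemma affineVK g v : g \in unitmx ->
  cancel (affine (invmx g) (invmx g *m v)) (@affine m N1 N2 g v).
Proof.
by move=> gu M; rewrite affine_comp mulmxA !mulmxV // mul1mx F2_addrr affine1.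
Qed.

(** The smallest code containing the all-one word and the rows of M. It is a complete invariant of
    the affine orbit of M, by [gen_affine] and [gen_eq_affine]. *)
Definition gen M : {set word N1 N2} := [set x | (x <= col_mx M (ones N1 N2))%MS].

Lemma mem_genP M x :
  reflect (exists u a, x = u *m M + a *: ones N1 N2) (x \in gen M).
Proof.
rewrite inE; apply: (iffP submxP) => [[u ->]|[u [a ->]]].
  exists (lsubmx u), (rsubmx u 0 0).
  rewrite -{1}[u]hsubmxK mul_row_col; congr (_ + _).
  by rewrite {1}[rsubmx u]mx11_scalar mul_scalar_mx.
by exists (row_mx u a%:M); rewrite mul_row_col mul_scalar_mx.
Qed.

Lemma gen_code M : is_code (gen M).
Proof.
split=> [|x y|a x]; rewrite !inE; first exact: sub0mx.
  exact: addmx_sub.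
exact: scalemx_sub.
Qed.

Lemma ones_gen M : ones N1 N2 \in gen M.
Proof. by apply/mem_genP; exists 0, 1; rewrite mul0mx add0r scale1r. Qed.

Lemma over_gen M : over (gen M) M.
Proof.
apply/forallP => i; apply/mem_genP; exists (delta_mx 0 i), 0.
by rewrite -rowE scale0r addr0.
Qed.

Lemma gen_min D M : is_code D -> ones N1 N2 \in D ->
  over D M = (gen M \subset D).
Proof.
move=> cD D1; apply/idP/subsetP => [/forallP DM x /mem_genP[u [a ->]]|sD].
  rewrite codeD ?codeZ // mulmx_sum_row; apply: code_sum => // i.
  exact: codeZ.
by apply/forallP => i; apply/sD; apply: (forallP (over_gen M)).
Qed.

Lemma gen_affine g v M : g \in unitmx -> gen (affine g v M) = gen M.
Proof.
have sub g' v' M' : gen (affine g' v' M') \subset gen M'.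
  rewrite -gen_min ?ones_gen //; last exact: gen_code.
  by apply: over_affine; [exact: gen_code|exact: ones_gen|exact: over_gen].
by move=> gu; apply/eqP; rewrite eqEsubset sub -{1}(affineK v gu M) sub.
Qed.

(* Modulo the all-one word, matrices with equal row space differ by an element of GL_m. *)
Lemma gen_eq_affine M M' : gen M = gen M' ->
  exists g v, g \in unitmx /\ M' = affine g v M.
Proof.
move=> gE; pose Q := cokermx (ones N1 N2).
have QP (A : mat) : A *m Q = 0 -> exists v, A = v *m ones N1 N2.
  by move/eqP; rewrite -submxE => /submxP.
have onesQ : ones N1 N2 *m Q = 0 by apply: mulmx_coker.
have sub A B : gen A = gen B -> (A *m Q <= B *m Q)%MS.
  move=> AB; apply/row_subP => i; rewrite row_mul.
  have := forallP (over_gen A) i; rewrite AB => /mem_genP[u [a ->]].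
  by rewrite mulmxDl -scalemxAl onesQ scaler0 addr0 -mulmxA submxMl.
have /eqmxMunitP[g gu gE'] : (M' *m Q == M *m Q)%MS by rewrite !sub.
have [v vE] : exists v, M' - g *m M = v *m ones N1 N2.
  by apply: QP; rewrite mulmxBl gE' mulmxA subrr.
by exists g, v; split=> //; rewrite /affine -vE addrC subrK.
Qed.

End Affine.

(** [row_ebase u] completes the line of u to a basis; its first row is u itself because 1 is the
    only unit of F_2. *)
Lemma unitmx_row0 m (u : 'rV['F_2]_m.+1) : u != 0 ->
  exists2 g : 'M_m.+1, g \in unitmx & row 0 g = u.
Proof.
move=> u0; exists (row_ebase u); first exact: row_ebase_unit.
have ru : \rank u = 1%N by apply/eqP; rewrite eqn_leq rank_leq_row lt0n mxrank_eq0.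
rewrite -[RHS]mulmx_ebase ru [col_ebase u]mx11_scalar mul_scalar_mx.
have -> : col_ebase u 0 0 = 1.
  have := col_ebase_unit u; rewrite unitmxE [col_ebase u]mx11_scalar det_scalar1 mxE eqxx mulr1n.
  by case: (F2_eq0or1 (col_ebase u 0 0)) => -> //; rewrite unitr0.
rewrite scale1r rowE; congr (_ *m _); apply/rowP => j; rewrite !mxE /=.
by rewrite eq_sym ltnS leqn0 -val_eqE /= eqn0Ngt; case: (val j).
Qed.

Lemma unitmx_col0 m (u : Fvec m.+1) : u != 0 ->
  exists2 g : 'M['F_2]_m.+1, g \in unitmx & g *m delta_mx 0 0 = u.
Proof.
move=> u0; have [|g gu gE] := @unitmx_row0 m u^T; first by rewrite -trmx0 (inj_eq trmx_inj).
exists g^T; first by rewrite unitmx_tr.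
by rewrite -colE -tr_row gE trmxK.
Qed.

Section GenAdmissible.
Variables (m N1 N2 : nat).
Local Notation mat := 'M['F_2]_(m.+1, N1 + N2).

(** Every nonzero u is the first row of an invertible g, so all words u M + a 1 with u nonzero are
    doubly-even. There remain 0 and the all-one word; the latter is the sum of two such words and is
    handled by [dvd4_ones]. *)
Lemma gen_admissible (M : mat) :
  (forall g v, g \in unitmx -> (4 %| wt (row 0%R (affine g v M)))%Z) ->
  admissible (gen M).
Proof.
move=> M4; apply/and3P; split; [exact/codebP/gen_code| |exact: ones_gen].
have rowE' g a : row 0 (affine g (a *: delta_mx 0 0) M) = row 0 g *m M + a *: ones N1 N2.
  rewrite /affine linearD /= !row_mul; congr (_ + _).
  rewrite (_ : row 0 _ = a%:M) ?mul_scalar_mx //.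
  by apply/rowP => j; rewrite !mxE !ord1 eqxx mulr1.
have comb u a : u != 0 -> (4 %| wt (u *m M + a *: ones N1 N2))%Z.
  by case/unitmx_row0 => g gu <-; rewrite -rowE' M4.
have e0 : delta_mx 0 0 != 0 :> 'rV['F_2]_m.+1.
  by apply/eqP => /matrixP/(_ 0 0)/eqP; rewrite !mxE.
have ones4 : (4 %| wt (ones N1 N2))%Z.
  have := comb _ 0 e0; have := comb _ 1 e0; rewrite scale0r scale1r addr0.
  by move=> h1 h0; apply: dvd4_ones h0 h1.
apply/forall_inP => x /mem_genP[u [a ->]].
have [->|] := eqVneq u 0; last exact: comb.
rewrite mul0mx add0r; case: (F2_eq0or1 a) => ->; rewrite ?scale1r // scale0r.
by rewrite wtE big1 // => j _; rewrite mxE mulr0.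
Qed.

End GenAdmissible.

(** * The generators acting on coefficient functions *)

Section Invariance.
Variables (K : numClosedFieldType) (m N1 N2 : nat).
Local Notation mat := 'M['F_2]_(m.+1, N1 + N2).
Implicit Types (t : mat -> K) (p : cpoly K m.+1).

Lemma act_m_tens g v t : g \in unitmx ->
  act (m_gen K g v) (tens (t \o affine g v)) = tens t.
Proof.
move=> gu; rewrite /tens act_sum.
rewrite [RHS](reindex_inj (can_inj (affineK v gu))) /=; apply: eq_bigr => M _.
by rewrite actZ act_m_nu.
Qed.

Lemma tens_affine p t g v : clifford_invariant p -> g \in unitmx ->
  p = tens t -> p = tens (t \o affine g v).
Proof.
move=> pinv gu pt; have gu' : invmx g \in unitmx by rewrite unitmx_inv.
rewrite -(act_m_tens (invmx g *m v) _ gu') -{1}(pinv _ (cl_m _ (invmx g *m v) gu')).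
by rewrite pt; congr (act _ _); apply: eq_tens => M /=; rewrite affineVK.
Qed.

Lemma act_d_tens S t :
  act (d_gen K S) (tens t) = tens (fun M => 'i ^ quadM S M * t M).
Proof.
by rewrite /tens act_sum; apply: eq_bigr => M _; rewrite actZ act_d_nu scalerA mulrC.
Qed.

Lemma quadM_delta (M : mat) : quadM (delta_mx 0 0) M = wt (row 0 M).
Proof.
rewrite quadME (bigD1 0) //= [X in _ + X]big1 => [|a /negbTE a0]; last first.
  by rewrite big1 // => b _; rewrite mxE a0 mul0r.
rewrite (bigD1 0) //= big1 => [|b /negbTE b0]; last by rewrite mxE b0 mul0r.
by rewrite !addr0 mxE !eqxx mul1r zdotxx.
Qed.

(** The matrix S with single entry 1 at (0,0) multiplies t by i to the weight of the first row.
    Averaging over its powers 0 to 3 yields the indicator that 4 divides this weight. *)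
Lemma tens_row0 p t : clifford_invariant p -> p = tens t ->
  p = tens (fun M => (4 %| wt (row 0%R M))%Z%:R * t M).
Proof.
move=> pinv pt; pose x (M : mat) : K := 'i ^ wt (row 0 M).
have dT : (delta_mx 0 0)^T = delta_mx 0 0 :> 'M[int]_m.+1 by rewrite trmx_delta.
have pk k : p = tens (fun M => x M ^+ k * t M).
  elim: k => [|k IHk]; first by rewrite {1}pt; apply: eq_tens => M; rewrite expr0 mul1r.
  rewrite -(pinv _ (cl_d _ dT)) {1}IHk act_d_tens; apply: eq_tens => M.
  by rewrite quadM_delta exprS mulrA.
have n4 : 4%:R != 0 :> K by rewrite pnatr_eq0.
apply: (scalerI n4); rewrite -tensZ.
have -> : 4%:R *: p = \sum_(k < 4) p by rewrite sumr_const card_ord scaler_nat.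
rewrite (eq_bigr _ (fun (k : 'I_4) _ => pk k)) -tens_sum; apply: eq_tens => M.
rewrite -mulr_suml mulrA; congr (_ * _); rewrite -(expi_eq1 K) -/(x M).
have x4 : x M ^+ 4 = 1.
  by rewrite /x exprnP exprz_exp; apply/eqP; rewrite expi_eq1; lia.
case: eqP => [->|/eqP x1].
  by under eq_bigr do rewrite expr1n; rewrite sumr_const card_ord mulr1.
(* Geometric sum: multiplied by x - 1 it becomes x^4 - 1 = 0. *)
rewrite mulr0; apply: (mulfI (x := x M - 1)); first by rewrite subr_eq0.
by rewrite -subrX1 x4 subrr mulr0.
Qed.

Definition hadamard t (M : mat) : K :=
  sqrtC 2 ^- (N1 + N2) * \sum_w chi K (dot w (row 0 M)) * t (set_row0 w M).

Lemma row0_set_row0 w (M : mat) : row 0 (set_row0 w M) = w.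
Proof. by apply/rowP => j; rewrite !mxE. Qed.

Lemma set_row0K w (M : mat) : set_row0 (row 0 M) (set_row0 w M) = M.
Proof. by apply/matrixP => i j; rewrite !mxE; case: eqP => [->|]. Qed.

Lemma act_h_tens t : act (h_gen K m.+1) (tens t) = tens (hadamard t).
Proof.
rewrite /tens act_sum.
transitivity (\sum_(Mw : mat * word N1 N2)
   (t Mw.1 * (sqrtC 2 ^- (N1 + N2) * chi K (dot Mw.2 (row 0 Mw.1))))
      *: nu K (set_row0 Mw.2 Mw.1)).
  rewrite -(pair_bigA _ (fun M w => (t M * (sqrtC 2 ^- (N1 + N2)
     * chi K (dot w (row 0 M)))) *: nu K (set_row0 w M))) /=.
  apply: eq_bigr => M _; rewrite actZ act_h_nu scaler_sumr.
  by apply: eq_bigr => w _; rewrite scalerA.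
(* Exchanging w with the first row of M is an involution on the pairs (M, w). *)
rewrite (reindex_inj (h := fun Mw => (set_row0 Mw.2 Mw.1, row 0 Mw.1))) /=; last first.
  apply: (can_inj (g := fun Mw => (set_row0 Mw.2 Mw.1, row 0 Mw.1))) => -[M w] /=.
  by rewrite set_row0K row0_set_row0.
rewrite -(pair_bigA _ (fun M w => (t (set_row0 w M) * (sqrtC 2 ^- (N1 + N2)
     * chi K (dot (row 0 M) (row 0 (set_row0 w M))))) *:
     nu K (set_row0 (row 0 M) (set_row0 w M)))) /=.
apply: eq_bigr => M _; rewrite /hadamard mulr_sumr scaler_suml.
apply: eq_bigr => w _; rewrite set_row0K row0_set_row0 dotC; congr (_ *: _); ring.
Qed.

End Invariance.

(** * Spans of code indicators *)

Section Span.
Variables (K : numClosedFieldType) (m N1 N2 : nat).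
Local Notation mat := 'M['F_2]_(m, N1 + N2).
Implicit Types (t : mat -> K) (P : pred {set word N1 N2}).

Definition ind_span P t := exists a : {set word N1 N2} -> K,
  (forall C, ~~ P C -> a C = 0) /\ (forall M, t M = \sum_C a C * ind K C M).

Lemma ind_span_ext P t1 t2 : t1 =1 t2 -> ind_span P t1 -> ind_span P t2.
Proof. by move=> t12 [a [a0 aE]]; exists a; split=> // M; rewrite -t12. Qed.

Lemma ind_span0 P : ind_span P (fun=> 0).
Proof. by exists (fun=> 0); split=> // M; rewrite big1 // => C _; rewrite mul0r. Qed.

Lemma ind_spanD P t1 t2 :
  ind_span P t1 -> ind_span P t2 -> ind_span P (fun M => t1 M + t2 M).
Proof.
move=> [a [a0 aE]] [b [b0 bE]]; exists (fun C => a C + b C); split=> [C PC|M].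
  by rewrite a0 ?b0 ?addr0.
by rewrite aE bE -big_split; apply: eq_bigr => C _; rewrite mulrDl.
Qed.

Lemma ind_spanZ P c t : ind_span P t -> ind_span P (fun M => c * t M).
Proof.
move=> [a [a0 aE]]; exists (fun C => c * a C); split=> [C PC|M].
  by rewrite a0 ?mulr0.
by rewrite aE mulr_sumr; apply: eq_bigr => C _; rewrite mulrA.
Qed.

Lemma ind_span_sum P (I : finType) (Q : pred I) (F : I -> mat -> K) :
  (forall i, Q i -> ind_span P (F i)) -> ind_span P (fun M => \sum_(i | Q i) F i M).
Proof.
move=> FP; elim: (index_enum I) => [|i s IHs].
  by apply: ind_span_ext (ind_span0 P) => M; rewrite big_nil.
have [Qi|nQi] := boolP (Q i).
  apply: ind_span_ext (ind_spanD (FP i Qi) IHs) => M.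
  by rewrite big_cons Qi.
by apply: ind_span_ext IHs => M; rewrite big_cons (negbTE nQi).
Qed.

Lemma ind_span_ind P C : P C -> ind_span P (ind K C).
Proof.
move=> PC; exists (fun D => (D == C)%:R); split=> [D|M].
  by case: eqP => // ->; rewrite PC.
by rewrite (bigD1 C) //= eqxx mul1r big1 ?addr0 // => D /negbTE ->; rewrite mul0r.
Qed.

(** Moebius inversion by induction on the size of D: [ind K D] is the sum, over E contained in D, of
    the indicators of gen M = E. An E that occurs as some gen M contains the all-one word and
    inherits doubly-evenness from D, so it is admissible. *)
Lemma ind_span_gen D : admissible D ->
  ind_span (@admissible N1 N2) (fun M => (gen M == D)%:R).
Proof.
have [n] := ubnP #|D|; elim: n => // n IHn in D *; rewrite ltnS => Dn aD.
have cD := admissible_code aD.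
apply: (@ind_span_ext _ (fun M => ind K D M +
    (-1) * \sum_(E : {set word N1 N2} | E \proper D) (gen M == E)%:R)) => [M|].
  have -> : ind K D M = \sum_(E : {set word N1 N2} | E \subset D) (gen M == E)%:R.
    rewrite /ind (gen_min _ cD (admissible_ones aD)).
    have [sMD|sMD] := boolP (gen M \subset D).
      rewrite (bigD1 (gen M)) //= eqxx big1 ?addr0 // => E /andP[_ /negbTE].
      by rewrite eq_sym => ->.
    by rewrite big1 // => E ED; case: eqP => // ME; rewrite ME ED in sMD.
  rewrite (bigD1 D) //= mulN1r [X in _ + X - _](eq_bigl (fun E : {set word N1 N2} => E \proper D)) ?addrK //.
  by move=> E; rewrite properEneq andbC.
apply: ind_spanD; first exact: ind_span_ind.
apply/ind_spanZ/ind_span_sum => E ED.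
have [aE|naE] := boolP (admissible E).
  by apply: IHn => //; apply: leq_trans Dn; apply: proper_card.
apply: ind_span_ext (ind_span0 _) => M; case: eqP => // ME; case/negP: naE.
rewrite -ME; apply/and3P; split; [exact/codebP/gen_code| |exact: ones_gen].
apply/forall_inP => x; rewrite ME => /(subsetP (proper_sub ED)).
exact: admissible_wt.
Qed.

End Span.

(** * Averaging over the diagonal and affine generators *)

Section Parabolic.
Variables (K : numClosedFieldType) (m N1 N2 : nat).
Local Notation mat := 'M['F_2]_(m.+1, N1 + N2).
Implicit Types (t : mat -> K) (p : cpoly K m.+1).

Lemma tens_avg p (I : finType) (Q : pred I) (F : I -> mat -> K) (i0 : I) : Q i0 ->
  (forall i, Q i -> p = tens (F i)) ->
  p = tens (fun M => #|Q|%:R^-1 * \sum_(i | Q i) F i M).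
Proof.
move=> Qi0 pF; rewrite tensZ tens_sum (eq_bigr (fun=> p)) => [|i /pF <-//].
rewrite sumr_const -scaler_nat scalerA mulVf ?scale1r // pnatr_eq0.
by rewrite -lt0n; apply/card_gt0P; exists i0.
Qed.

(** Conjugating the restriction of [tens_row0] by each affine map in turn forces all transforms of M
    to have a doubly-even first row; [gen_admissible] then applies. *)
Lemma tens_admissible p t : clifford_invariant p -> p = tens t ->
  p = tens (fun M => (admissible (gen M))%:R * t M).
Proof.
move=> pinv pt; pose A := ('M['F_2]_m.+1 * Fvec m.+1)%type.
pose ok (M : mat) (gv : A) := (4 %| wt (row 0%R (affine gv.1 gv.2 M)))%Z.
pose s := [seq gv <- enum {: A} | gv.1 \in unitmx].
have pall r : all (fun gv : A => gv.1 \in unitmx) r ->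
    p = tens (fun M => (all (ok M) r)%:R * t M).
  elim: r => [_|[g v] r IHr /= /andP[gu /IHr {IHr}]].
    by rewrite {1}pt; apply: eq_tens => M; rewrite mul1r.
  set t' := fun M => _ => pt'.
  have gu' : invmx g \in unitmx by rewrite unitmx_inv.
  have := tens_affine (invmx g *m v) pinv gu' pt'.
  move/(tens_row0 pinv)/(tens_affine v pinv gu) => {1}->; apply: eq_tens => M /=.
  by rewrite affineK // /t' mulrA -natrM mulnb.
rewrite (pall s); last by apply/allP => gv; rewrite mem_filter => /andP[].
apply: eq_tens => M; congr (_%:R * _); congr nat_of_bool; apply/allP/idP => [M4|aM [g v]].
  by apply: gen_admissible => g v gu; apply: (M4 (g, v)); rewrite mem_filter mem_enum andbT.
rewrite mem_filter /= => /andP[gu _]; rewrite /ok /=.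
apply: (admissible_wt aM); rewrite -(gen_affine v M gu).
exact: (forallP (over_gen _)).
Qed.

(** After restriction to admissible [gen M], averaging over the affine group makes the coefficients
    constant on orbits, hence a function of [gen M], and [ind_span_gen] expands it. *)
Lemma invariant_ind_span p t : clifford_invariant p -> p = tens t ->
  exists2 t', p = tens t' & ind_span (@admissible N1 N2) t'.
Proof.
move=> pinv /(tens_admissible pinv); set t1 := fun M => _ => pt1.
pose A := ('M['F_2]_m.+1 * Fvec m.+1)%type.
pose Q := fun gv : A => gv.1 \in unitmx.
pose t2 M := \sum_(gv : A | Q gv) t1 (affine gv.1 gv.2 M).
have Q1 : Q (1%:M, 0) by rewrite /Q /= unitmx1.
have pt2 := tens_avg Q1 (fun gv Qgv => tens_affine gv.2 pinv Qgv pt1).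
exists (fun M => #|Q|%:R^-1 * t2 M) => //; apply: ind_spanZ.
have t2_affine g v M : g \in unitmx -> t2 (affine g v M) = t2 M.
  move=> gu; rewrite /t2.
  rewrite [RHS](reindex_inj (h := fun hw : A => (hw.1 *m g, hw.1 *m v + hw.2))) /=.
    apply: eq_big => [[h w]|[h w] _] /=; last by rewrite affine_comp.
    by rewrite /Q /= unitmx_mul gu andbT.
  move=> [h w] [h' w'] /= [/(congr1 (mulmx^~ (invmx g))) ].
  by rewrite /= -!mulmxA mulmxV // !mulmx1 => -> /addrI ->.
have t2_gen M M' : gen M = gen M' -> t2 M = t2 M'.
  by move/gen_eq_affine => [g [v [gu ->]]]; rewrite t2_affine.
have t2_0 M : ~~ admissible (gen M) -> t2 M = 0.
  move=> naM; rewrite /t2 big1 // => -[g v] gu.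
  by rewrite /t1 gen_affine // (negbTE naM) mul0r.
(* The value 0 is taken when no M generates D; the indicator of gen M = D is then zero anyway. *)
pose F D := if [pick M : mat | gen M == D] is Some M then t2 M else 0.
apply: (@ind_span_ext _ _ _ _ _ (fun M => \sum_(D | admissible D) F D * (gen M == D)%:R)) => [M|].
  have FE : F (gen M) = t2 M.
    rewrite /F; case: pickP => [M' /eqP /t2_gen //|/(_ M)]; by rewrite eqxx.
  have [aM|naM] := boolP (admissible (gen M)).
    rewrite (bigD1 (gen M)) //= eqxx mulr1 big1 ?addr0 // => D /andP[_ /negbTE].
    by rewrite eq_sym => ->; rewrite mulr0.
  rewrite t2_0 // big1 // => D aD; case: eqP => [MD|_]; last by rewrite mulr0.
  by rewrite MD aD in naM.
by apply: ind_span_sum => D aD; apply/ind_spanZ/ind_span_gen.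
Qed.

End Parabolic.

(** * Elimination of the codes that are not self-dual *)

Section Elimination.
Variables (K : numClosedFieldType) (m N1 N2 : nat).
Local Notation mat := 'M['F_2]_(m.+1, N1 + N2).
Local Notation word := (word N1 N2).
Implicit Types (t : mat -> K) (p : cpoly K m.+1) (C : {set word}).

(** The factor left by the Fourier transform of [ind K C]. By [card_dual] it is the square root of
    |C| / |C^perp| for a code C, which gives [alpha_eq1] and [alpha_lt1]. *)
Definition alpha C : K := sqrtC 2 ^- (N1 + N2) * #|C|%:R.

Lemma alpha_ge0 C : 0 <= alpha C.
Proof. by rewrite mulr_ge0 ?ler0n // invr_ge0 exprn_ge0 // sqrtC_ge0 ler0n. Qed.

Lemma alpha_sqr C : alpha C ^+ 2 = (2 ^ (N1 + N2))%:R^-1 * (#|C| ^ 2)%:R.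
Proof. by rewrite exprMn exprVn -exprM mulnC exprM sqrtCK !natrX. Qed.

Lemma alpha_eq1 C : is_code C -> dual_code C = C -> alpha C = 1.
Proof.
move=> cC sC; apply/eqP; rewrite -(@pexpr_eq1 _ _ 2) ?alpha_ge0 // alpha_sqr.
by rewrite -{1}sC -(card_dual K cC) sC mulnn mulVf // pnatr_eq0 -lt0n expn_gt0
  (cardD1 0) code0.
Qed.

Lemma alpha_lt1 C : admissible C -> dual_code C != C -> alpha C < 1.
Proof.
move=> aC nC; have cC := admissible_code aC.
rewrite -(@expr_lt1 _ 2) ?alpha_ge0 // alpha_sqr mulrC.
rewrite ltr_pdivrMr ?ltr0n ?expn_gt0 // mul1r ltr_nat -(card_dual K cC) -mulnn.
rewrite ltn_pmul2l; last by rewrite (cardD1 0) code0.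
by apply: proper_card; rewrite properEneq eq_sym nC admissible_dual.
Qed.

Definition tail_over C (M : mat) := [forall i, (i != 0) ==> (row i M \in C)].

Lemma overE C (M : mat) : over C M = (row 0 M \in C) && tail_over C M.
Proof.
apply/forallP/andP => [CM|[C0 /forallP CM] i].
  by split=> //; apply/forallP => i; rewrite CM implybT.
by have := CM i; case: eqP => [->|].
Qed.

Lemma tail_set_row0 C w (M : mat) : tail_over C (set_row0 w M) = tail_over C M.
Proof.
apply: eq_forallb => i; case: (i =P 0) => //= /eqP/negbTE i0.
suff -> : row i (set_row0 w M) = row i M by [].
by apply/rowP => j; rewrite !mxE i0.
Qed.

Lemma hadamard_ind C (M : mat) : is_code C ->
  hadamard (ind K C) M = alpha C * ((row 0 M \in dual_code C) && tail_over C M)%:R.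
Proof.
move=> cC; rewrite /hadamard /alpha -mulrA; congr (_ * _).
rewrite -mulnb natrM mulrA -natrM -sum_chi_code // mulr_suml [RHS]big_mkcond.
apply: eq_bigr => w _; rewrite /ind overE row0_set_row0 tail_set_row0.
by case: (w \in C); rewrite //= mulr0.
Qed.

(** For admissible C this is a union of cosets of C, so each extension of C by one of its words is
    counted |C| times. *)
Definition doubly_even_cosets C : {set word} :=
  [set w in dual_code C | (w \notin C) && (4 %| wt w)%Z].

Lemma mem_doubly_even_cosets C w : (w \in doubly_even_cosets C)
  = [&& w \in dual_code C, w \notin C & (4 %| wt w)%Z].
Proof. by rewrite in_set. Qed.

Lemma doubly_even_cosets_coset C w r : admissible C -> w + r \in C ->
  w \in doubly_even_cosets C -> r \in doubly_even_cosets C.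
Proof.
move=> aC wrC; have cC := admissible_code aC.
have rE : r = w + (w + r) by rewrite addrA F2_addrr add0r.
have dC := subsetP (admissible_dual aC).
rewrite !mem_doubly_even_cosets => /and3P[wd wC w4]; apply/and3P; split.
- by rewrite rE (codeD (dual_is_code C) wd) // dC.
- by apply: contra wC => rC; rewrite -(codeDl _ cC rC) addrC.
- rewrite rE dvd4_wtD ?(admissible_wt aC wrC) // dotC.
  by move: wd; rewrite mem_dual => /forall_inP; apply.
Qed.

Lemma sum_doubly_even_cosets C r : admissible C ->
  \sum_(w in doubly_even_cosets C) (w + r \in C)%:R
    = #|C|%:R * (r \in doubly_even_cosets C)%:R :> K.
Proof.
move=> aC; have [rW|rW] := boolP (r \in doubly_even_cosets C); last first.
  rewrite mulr0 big1 // => w wW; case: (boolP (w + r \in C)) => // wr.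
  by rewrite (doubly_even_cosets_coset aC wr wW) in rW.
rewrite mulr1 -sum1_card natr_sum [RHS]big_mkcond [LHS]big_mkcond /=.
rewrite [RHS](reindex_inj (addIr r)) /=; apply: eq_bigr => w _.
case: (boolP (w + r \in C)) => [wr|_]; last by rewrite if_same.
by rewrite (@doubly_even_cosets_coset C r w) // addrC.
Qed.

(** The Fourier transform puts the first row into the dual; the weight condition leaves C and the
    doubly-even cosets. Membership in the latter is written as a sum over w, where each coset is hit
    |C| times. *)
Lemma hadamard_ind_doubly_even C (M : mat) : admissible C ->
  (4 %| wt (row 0%R M))%Z%:R * hadamard (ind K C) M = alpha C * (ind K C M +
    #|C|%:R^-1 * \sum_(w in doubly_even_cosets C)
       ((w + row 0 M \in C) && tail_over C M)%:R).
Proof.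
move=> aC; have cC := admissible_code aC.
rewrite hadamard_ind // mulrCA; congr (_ * _); rewrite /ind overE.
have [tM|_] := boolP (tail_over C M); last first.
  rewrite !andbF mulr0 add0r big1 ?mulr0 // => w _; by rewrite andbF.
under eq_bigr => w _ do rewrite andbT.
rewrite !andbT sum_doubly_even_cosets // mulrA mulVf ?mul1r; last first.
  by rewrite pnatr_eq0 (cardD1 0) code0.
rewrite mem_doubly_even_cosets; have [rC|rC] /= := boolP (row 0 M \in C).
  by rewrite (admissible_wt aC rC) (subsetP (admissible_dual aC)) // addr0 mulr1.
by rewrite add0r -natrM mulnb andbC.
Qed.

Lemma ind_affine C g v (M : mat) : is_code C -> ones N1 N2 \in C -> g \in unitmx ->
  ind K C (affine g v M) = ind K C M.
Proof.
move=> cC C1 gu; rewrite /ind; congr (_%:R); congr nat_of_bool; apply/idP/idP.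
  by rewrite -{2}(affineK v gu M); apply: over_affine.
exact: over_affine.
Qed.

(** The average over GL restores the symmetry between rows that [hadamard] breaks. *)
Definition coset_avg t (M : mat) : K :=
  #|[pred g : 'M['F_2]_m.+1 | g \in unitmx]|%:R^-1 *
  \sum_(g : 'M['F_2]_m.+1 | g \in unitmx)
     (4 %| wt (row 0%R (affine g 0%R M)))%Z%:R * hadamard t (affine g 0 M).

Lemma tens_coset_avg p t : clifford_invariant p -> p = tens t ->
  p = tens (coset_avg t).
Proof.
move=> pinv pt.
have: p = tens (hadamard t) by rewrite -act_h_tens -pt pinv //; apply: cl_h.
move/(tens_row0 pinv) => pt'.
exact: (tens_avg (unitmx1 _ m.+1) (fun g gu => tens_affine 0 pinv gu pt')).
Qed.

(** For M over [extend C w], let u mark the rows lying outside C. The summand tests g u = e_0, which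
    has no invertible solution for u = 0 and, for every nonzero u, as many as the stabilizer of e_0
    has elements. The case u = 0 is M over C, whence the difference of indicators. *)
Lemma sum_unitmx_ind C w (M : mat) : admissible C -> w \notin C ->
  admissible (extend C w) ->
  \sum_(g : 'M['F_2]_m.+1 | g \in unitmx)
     ((w + row 0 (affine g 0 M) \in C) && tail_over C (affine g 0 M))%:R
  = #|[pred g : 'M['F_2]_m.+1 | (g \in unitmx) && (g *m delta_mx 0 0 == delta_mx 0 0 :> Fvec m.+1)]|%:R
    * (ind K (extend C w) M - ind K C M).
Proof.
move=> aC wC aE; have cC := admissible_code aC; have cE := admissible_code aE.
have subE i (M' : mat) : row i M' \in C -> row i M' \in extend C w.
  exact: (subsetP (sub_extend C w)).
have [oM|noM] := boolP (over (extend C w) M); last first.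
  rewrite /ind (negbTE noM) (_ : over C M = false) ?subrr ?mulr0; last first.
    apply: contraNF noM => /forallP CM; apply/forallP => i; exact: subE.
  rewrite big1 // => g gu; case: andP => // -[r0 /forallP rt]; case/negP: noM.
  rewrite -(affineK 0 gu M); apply: over_affine; rewrite ?admissible_ones //.
  apply/forallP => i; have := rt i; case: (i =P 0) => [-> _|_ /=]; last exact: subE.
  by rewrite inE r0 orbT.
pose u : Fvec m.+1 := \col_i (row i M \notin C)%:R.
have rowC i : row i M + u i 0 *: w \in C.
  rewrite mxE; have [rC|rC] := boolP (row i M \in C); first by rewrite scale0r addr0.
  by have := forallP oM i; rewrite inE (negbTE rC) /= scale1r addrC.
have rowgC (g : 'M_m.+1) i : row i (affine g 0 M) + (g *m u) i 0 *: w \in C.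
  have -> : row i (affine g 0 M) + (g *m u) i 0 *: w
      = \sum_k g i k *: (row k M + u k 0 *: w).
    rewrite /affine mul0mx addr0 row_mul mulmx_sum_row.
    under [RHS]eq_bigr => k _ do rewrite scalerDr scalerA.
    rewrite big_split /= -scaler_suml; congr (_ + _ *: _); last by rewrite mxE.
    by apply: eq_bigr => k _; rewrite mxE.
  by apply: code_sum => // k; apply: codeZ.
have memg (g : 'M_m.+1) i : (row i (affine g 0 M) \in C) = ((g *m u) i 0 == 0).
  have := rowgC g i; case: (F2_eq0or1 ((g *m u) i 0)) => ->.
    by rewrite scale0r addr0 eqxx.
  rewrite scale1r => rw; apply: contraNF wC => rC.
  by rewrite -(codeDl _ cC rC).
have memwg (g : 'M_m.+1) i : (w + row i (affine g 0 M) \in C) = ((g *m u) i 0 == 1).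
  have := rowgC g i; case: (F2_eq0or1 ((g *m u) i 0)) => ->.
    rewrite scale0r addr0 => rC; apply: contraNF wC => wr.
    by rewrite -(codeDl _ cC rC) addrC.
  by rewrite scale1r eqxx addrC.
have cond (g : 'M_m.+1) : (w + row 0 (affine g 0 M) \in C) && tail_over C (affine g 0 M)
    = (g *m u == delta_mx 0 0).
  rewrite memwg; apply/andP/eqP => [[/eqP gu0 /forallP gut]|guE].
    apply/colP => i; rewrite [RHS]mxE eqxx andbT; case: (i =P 0) => [->//|/eqP i0].
    by have := gut i; rewrite i0 memg => /eqP.
  split; first by rewrite guE mxE.
  by apply/forallP => i; rewrite memg guE mxE; apply/implyP => /negbTE ->.
under eq_bigr => g _ do rewrite cond.
rewrite /ind oM; have [u0|u0] := eqVneq u 0.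
  rewrite (_ : over C M) ?subrr ?mulr0; last first.
    apply/forallP => i; have /colP/(_ i) := u0; rewrite !mxE.
    by case: (_ \in C).
  rewrite big1 // => g _; rewrite u0 mulmx0; case: eqP => // /colP/(_ 0)/eqP.
  by rewrite !mxE.
rewrite (_ : over C M = false) ?subr0 ?mulr1; last first.
  apply: contraNF u0 => /forallP CM; apply/eqP/colP => i.
  by rewrite !mxE CM.
have [h hu hE] := unitmx_col0 u0.
rewrite -sum1_card natr_sum.
(* As h e_0 = u, right translation by the inverse of h carries the stabilizer of e_0 to the
   solutions of g u = e_0. *)
rewrite (reindex_inj (h := mulmx^~ (invmx h))) /=; last first.
  by move=> g g' /(congr1 (mulmx^~ h)); rewrite /= !mulmxKV.
rewrite big_mkcond [RHS]big_mkcond; apply: eq_bigr => g _.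
rewrite unitmx_mul unitmx_inv hu andbT -hE -mulmxA mulKmx // inE.
by case: (g \in unitmx); case: eqP.
Qed.

(** By orbit counting, the quotient of the two numbers of matrices is the reciprocal of the number
    of nonzero vectors. *)
Definition mu C : K := alpha C * (#|C|%:R^-1 *
  (#|[pred g : 'M['F_2]_m.+1 | g \in unitmx]|%:R^-1 *
   #|[pred g : 'M['F_2]_m.+1 |
       (g \in unitmx) && (g *m delta_mx 0 0 == delta_mx 0 0 :> Fvec m.+1)]|%:R)).

Definition lam C : K := alpha C - #|doubly_even_cosets C|%:R * mu C.

Lemma coset_avg_ind C (M : mat) : admissible C ->
  coset_avg (ind K C) M = lam C * ind K C M
    + \sum_(w in doubly_even_cosets C) mu C * ind K (extend C w) M.
Proof.
move=> aC; have cC := admissible_code aC; rewrite /coset_avg.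
under eq_bigr => g _ do rewrite hadamard_ind_doubly_even //.
rewrite -[in LHS]mulr_sumr big_split /= -[in LHS]mulr_sumr [X in _ + _ * X]exchange_big /=.
rewrite (eq_bigr (fun=> ind K C M)) => [|g gu]; last first.
  by rewrite ind_affine // admissible_ones.
rewrite (eq_bigr (fun w => #|[pred g : 'M['F_2]_m.+1 |
       (g \in unitmx) && (g *m delta_mx 0 0 == delta_mx 0 0 :> Fvec m.+1)]|%:R *
       (ind K (extend C w) M - ind K C M))) => [|w]; last first.
  rewrite mem_doubly_even_cosets => /and3P[wd wC w4].
  by apply: sum_unitmx_ind => //; apply: extend_admissible.
rewrite sumr_const -!mulr_sumr sumrB sumr_const.
rewrite -[ind K C M *+ #|doubly_even_cosets C|]mulr_natl -[_ *+ _]mulr_natl /lam /mu.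
have G0 : #|[pred g : 'M['F_2]_m.+1 | g \in unitmx]|%:R != 0 :> K.
  by rewrite pnatr_eq0 -lt0n; apply/card_gt0P; exists 1%:M; rewrite inE unitmx1.
have C0 : #|C|%:R != 0 :> K by rewrite pnatr_eq0 (cardD1 0) code0.
rewrite -[#|[eta _]|]/(#|[pred g : 'M['F_2]_m.+1 | g \in unitmx]|).
move: G0 C0; set G := (X in X%:R != 0 -> _); move=> G0 C0.
by field; rewrite G0 C0.
Qed.

Lemma mu_ge0 C : 0 <= mu C.
Proof. by rewrite mulr_ge0 ?alpha_ge0 // !mulr_ge0 ?invr_ge0 ?ler0n. Qed.

(** As [mu C] is nonnegative, [lam C] is at most [alpha C], which is less than 1. *)
Lemma lam_neq1 C : admissible C -> dual_code C != C -> lam C != 1.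
Proof.
move=> aC nC; rewrite lt_eqF // (le_lt_trans _ (alpha_lt1 aC nC)) //.
by rewrite /lam gerBl mulr_ge0 ?ler0n ?mu_ge0.
Qed.

Definition self_dualb C := admissible C && (dual_code C == C).

Lemma coset_avg_lin (a : {set word} -> K) t (M : mat) :
  (forall M, t M = \sum_C a C * ind K C M) ->
  coset_avg t M = \sum_C a C * coset_avg (ind K C) M.
Proof.
move=> tE; rewrite /coset_avg; under [RHS]eq_bigr => C _ do rewrite mulrCA mulr_sumr.
rewrite -mulr_sumr exchange_big; congr (_ * _); apply: eq_bigr => g _ /=.
under [RHS]eq_bigr => C _ do rewrite mulrCA.
rewrite -mulr_sumr; congr (_ * _); rewrite /hadamard.
under [RHS]eq_bigr => C _ do rewrite mulrCA mulr_sumr.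
rewrite -mulr_sumr exchange_big; congr (_ * _); apply: eq_bigr => w _ /=.
rewrite tE mulr_sumr; apply: eq_bigr => C _; ring.
Qed.

(* [coset_avg] fixes p and is triangular for inclusion on the indicators, with diagonal
   entry different from 1 at codes that are not self-dual; hence a minimal such code
   can be removed from any expansion of p. *)
Lemma eliminate p (L : {set {set word}}) t : clifford_invariant p ->
  (forall C, C \in L -> admissible C) ->
  (forall C D, C \in L -> dual_code C != C -> admissible D -> C \proper D -> D \in L) ->
  p = tens t -> ind_span (mem L) t ->
  exists2 t', p = tens t' & ind_span self_dualb t'.
Proof.
move=> pinv; have [n] := ubnP #|L|; elim: n => // n IHn in L t *; rewrite ltnS => Ln aL upL pt tL.
have [/existsP[C0 C0P]|noC] := boolP [exists C, (C \in L) && (dual_code C != C)]; last first.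
  exists t => //; case: tL => a [a0 aE]; exists a; split=> // C.
  move=> nC; apply: a0; apply: contra nC => /= CL; rewrite /self_dualb aL //=.
  by apply: contraNT noC => nC; apply/existsP; exists C; rewrite nC andbT.
case: (@arg_minnP _ C0 (fun C => (C \in L) && (dual_code C != C))
  (fun C : {set word} => #|C|) C0P) => C /andP[CL nC] Cmin {C0 C0P}.
have aC := aL C CL; have l1 : 1 - lam C != 0 by rewrite subr_eq0 eq_sym lam_neq1.
(* Both [coset_avg t] and t represent p, hence so does t'. Subtracting [lam C * t] cancels the
   diagonal term at C. *)
pose t' M := (1 - lam C)^-1 * (coset_avg t M + - lam C * t M).
have ptC := tens_coset_avg pinv pt.
have pt' : p = tens t'.
  have -> : tens t' = (1 - lam C)^-1 *: (tens (coset_avg t) + - lam C *: tens t).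
    by rewrite -tensZ -tensD -tensZ.
  rewrite -ptC -pt -{2}[p]scale1r -scalerDl.
  by rewrite scalerA mulVf ?scale1r.
apply: (IHn (L :\ C) t') => //.
- by move: Ln; rewrite (cardsD1 C) CL.
- by move=> D /setD1P[_ /aL].
(* By minimality of |C|, a code properly containing a non-self-dual member of L is larger than C, so
   removing C keeps the closure condition. *)
- move=> D E /setD1P[DC DL] nD aE DE; rewrite in_setD1 (upL D) // andbT.
  apply: contraTneq (proper_card DE) => ->; rewrite -leqNgt; apply: Cmin.
  by rewrite DL.
case: tL => a [a0 aE]; apply: ind_spanZ.
apply: (@ind_span_ext _ _ _ _ _ (fun M => \sum_(D in L) a D *
   (coset_avg (ind K D) M + - lam C * ind K D M))) => [M|].
  rewrite (coset_avg_lin _ aE) aE mulr_sumr -big_split /= [LHS]big_mkcond.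
  apply: eq_bigr => D _; case: ifP => DL; first by ring.
  by rewrite a0 /= ?DL //; ring.
apply: ind_span_sum => D DL; have aD := aL D DL; apply: ind_spanZ.
apply: (@ind_span_ext _ _ _ _ _ (fun M => (lam D - lam C) * ind K D M
  + \sum_(w in doubly_even_cosets D) mu D * ind K (extend D w) M)) => [M|].
  by rewrite coset_avg_ind //; ring.
apply: ind_spanD.
  have [->|DC] := eqVneq D C.
    by apply: ind_span_ext (ind_span0 _ _ _) => M; rewrite subrr mul0r.
  by apply/ind_spanZ/ind_span_ind; rewrite inE /= in_setD1 DC.
apply: ind_span_sum => w; rewrite mem_doubly_even_cosets => /and3P[wd wD w4].
apply/ind_spanZ/ind_span_ind => /=.
have nD : dual_code D != D by apply: contraNneq wD => <-.
have DE := extend_proper (admissible_code aD) wD.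
rewrite in_setD1 (upL D) ?extend_admissible // andbT.
apply: contraTneq (proper_card DE) => ->; rewrite -leqNgt; apply: Cmin.
by rewrite DL.
Qed.

End Elimination.

(** * Invariance and spanning of the weight enumerators *)

Section Spanning.
Variables (K : numClosedFieldType) (m N1 N2 : nat).
Local Notation mat := 'M['F_2]_(m.+1, N1 + N2).
Local Notation word := (word N1 N2).
Implicit Types (C D : {set word}) (p : cpoly K m.+1).

(** The generators d_S, m_{g,v} and h use in turn that C is doubly-even, contains the all-one word,
    and is self-dual. *)
Lemma ccwe_invariant C : DE_SD_code C -> clifford_invariant (ccwe K m.+1 C).
Proof.
move/DE_SD_admissible => /andP[aC /eqP sC]; have cC := admissible_code aC.
rewrite ccweE; apply: invariant_of_generators => [S ST|g v gu|].
- rewrite act_d_tens; apply: eq_tens => M; rewrite /ind.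
  have [oM|_] := boolP (over C M); last by rewrite mulr0.
  by rewrite mulr1; apply/eqP; rewrite expi_eq1 (dvd4_quadM aC).
- rewrite -[RHS](act_m_tens v _ gu); congr (act _ _); apply: eq_tens => M /=.
  by rewrite ind_affine // admissible_ones.
- rewrite act_h_tens; apply: eq_tens => M.
  by rewrite hadamard_ind // sC -overE alpha_eq1 // mul1r.
Qed.

Lemma ccwe_span p : clifford_invariant p -> bihomog N1 N2 p ->
  exists c : {set word} -> K, (forall C, ~ DE_SD_code C -> c C = 0) /\
    p = \sum_(C : {set word}) c C *: ccwe K m.+1 C.
Proof.
move=> pinv /bihomog_tens[t0 /(invariant_ind_span pinv)[t1 pt1 t1P]].
have [|C D|||t pt [a [a0 aE]]] := @eliminate K m N1 N2 p [set C | admissible C] t1 pinv.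
- by move=> C; rewrite inE.
- by rewrite !inE.
- exact: pt1.
- by case: t1P => a [a0 aE]; exists a; split=> // C; rewrite /= inE; apply: a0.
exists a; split=> [C nC|]; first by apply: a0; apply/negP => /DE_SD_admissible.
rewrite pt (eq_tens aE) tens_sum; apply: eq_bigr => C _.
by rewrite tensZ ccweE.
Qed.

End Spanning.

(** * Code equivalence and linear independence *)

Section Equivalence.
Variables (K : numClosedFieldType) (m N1 N2 : nat).
Local Notation mat := 'M['F_2]_(m, N1 + N2).
Local Notation word := (word N1 N2).
Implicit Types (C D : {set word}) (s : 'S_(N1 + N2)).

Lemma permute_wordE s (x : word) : permute_word s x = col_perm s x.
Proof. by apply/rowP => j; rewrite !mxE. Qed.

Lemma col_perm_inj k s : injective (@col_perm 'F_2 k (N1 + N2) s).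
Proof.
by apply: (can_inj (g := col_perm s^-1)) => M; rewrite -col_permM mulVg col_perm1.
Qed.

Lemma nu_col_perm s (M : mat) : block_perm s -> nu K (col_perm s M) = nu K M.
Proof.
move=> sb; rewrite !nuE [RHS](reindex_inj (@perm_inj _ s)) /=.
apply: eq_bigr => j _; rewrite /var /block_var sb.
suff -> : col j (col_perm s M) = col (s j) M by [].
by apply/colP => i; rewrite !mxE.
Qed.

Lemma over_col_perm s C (M : mat) :
  over [set permute_word s c | c in C] (col_perm s M) = over C M.
Proof.
apply: eq_forallb => i.
have -> : row i (col_perm s M) = permute_word s (row i M).
  by apply/rowP => j; rewrite !mxE.
apply: mem_imset => x y; rewrite !permute_wordE; exact: col_perm_inj.
Qed.

Lemma ccwe_equiv C D : code_equiv C D -> ccwe K m C = ccwe K m D.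
Proof.
case=> s [sb ->]; rewrite /ccwe [RHS](reindex_inj (@col_perm_inj m s)) /=.
by apply: eq_big => [M|M _]; rewrite ?nu_col_perm // -!/(over _ _) over_col_perm.
Qed.

(** The exponents count the columns tagged by their block, so equal monomials have tagged column
    lists that are permutations of each other; the tags make the permutation respect the blocks. *)
Lemma mon_eq_col_perm (M M' : mat) : mon M = mon M' ->
  exists s, block_perm s /\ M' = col_perm s M.
Proof.
pose T (M : mat) := [tuple block_var j (col j M) | j < N1 + N2].
have countT M0 x : count_mem x (T M0) = mon M0 (enum_rank x).
  rewrite /T /= /mon mnm_sumE -sum1_count big_map big_mkcond /= big_enum /=.
  apply: eq_bigr => j _; rewrite mnm1E (inj_eq enum_rank_inj).
  by case: eqP.
move=> MM'; have /tuple_permP[s sE] : perm_eq (T M') (T M).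
  by apply/allP => x _ /=; rewrite !countT MM'.
exists s; have sT j : block_var j (col j M') = block_var (s j) (col (s j) M).
  have := congr1 (fun r => nth (inl 0) r j) sE.
  by rewrite -!tnth_nth /= !tnth_mktuple.
split=> [j|].
  by have := sT j; rewrite /block_var; case: (j < N1)%N; case: (s j < N1)%N.
apply/matrixP => i j; rewrite mxE.
suff /colP/(_ i) : col j M' = col (s j) M by rewrite !mxE.
have := sT j; rewrite /block_var.
by case: (j < N1)%N; case: (s j < N1)%N => // -[].
Qed.

(** Each new generator, chosen in D outside E, doubles E, so k of them suffice; if E already fills D
    the rows are padded with 0. *)
Lemma code_generators k (E D : {set word}) : is_code E -> is_code D -> E \subset D ->
  (#|D| <= 2 ^ k * #|E|)%N ->
  exists M : 'M['F_2]_(k, N1 + N2), over D M /\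
    forall D0, is_code D0 -> E \subset D0 -> over D0 M -> D \subset D0.
Proof.
elim: k => [|k IHk] in E *; move=> cE cD ED leDE.
  exists 0; split; first by apply/forallP; case.
  move=> D0 _ ED0 _; suff -> : D = E by [].
  by apply/eqP; rewrite eq_sym eqEcard ED; rewrite mul1n in leDE.
have [DE|/subsetPn[w wD wE]] := boolP (D \subset E).
  exists 0; split; first by apply/forallP => i; rewrite row0 code0.
  by move=> D0 _ ED0 _; apply: subset_trans ED0.
have E'D : extend E w \subset D.
  apply/subsetP => x; rewrite inE => /orP[/(subsetP ED)//|/(subsetP ED)].
  by rewrite codeDl.
have [|M [DM Mgen]] := IHk _ (extend_code w cE) cD E'D.
  by rewrite card_extend // mulnA -expnSr.
pose M1 : 'M['F_2]_(k.+1, N1 + N2) :=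
  \matrix_(i < k.+1) (if unlift ord0 i is Some j then row j M else w).
exists M1; split=> [|D0 cD0 ED0 /forallP D0M].
  apply/forallP => i; rewrite rowK; case: unlift => [j|//].
  exact: (forallP DM).
have wD0 : w \in D0 by have := D0M ord0; rewrite rowK unlift_none.
apply: Mgen => //; last by apply/forallP => j; have := D0M (lift ord0 j); rewrite rowK liftK.
apply/subsetP => x; rewrite inE => /orP[/(subsetP ED0)//|/(subsetP ED0)].
by rewrite codeDl.
Qed.

(** Starting from the span of the all-one word, of size 2, m rows reach size 2^(m+1), while |D| =
    2^(N/2). This is the source of the bound N/2 <= m+1. *)
Lemma self_dual_generators D : DE_SD_code D -> (N1 + N2 <= 2 * m.+1)%N ->
  exists M : mat, over D M /\ forall D0, is_code D0 -> ones N1 N2 \in D0 ->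
    over D0 M -> D \subset D0.
Proof.
move/DE_SD_admissible => /andP[aD /eqP sD] Nm; have cD := admissible_code aD.
have card2 : (#|D| * #|D|)%N = (2 ^ (N1 + N2))%N by rewrite -{2}sD (card_dual K).
pose E : {set word} := [set 0; ones N1 N2].
have cE : is_code E.
  apply/codebP; rewrite /codeb !inE eqxx /=; apply/forall_inP => x; rewrite !inE => xE.
  apply/forall_inP => y; rewrite !inE => yE.
  by case/orP: xE => /eqP ->; case/orP: yE => /eqP ->;
    rewrite ?addr0 ?add0r ?F2_addrr !eqxx ?orbT.
have ED : E \subset D by rewrite subUset !sub1set code0 ?admissible_ones.
have [|M [DM Mgen]] := @code_generators m E D cE cD ED.
  (* In length 0 the all-one word is 0 and E has size 1, but so has D. *)
  have [N0|N0] := posnP (N1 + N2).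
    have := card2; have -> : (2 ^ (N1 + N2) = 1)%N by rewrite N0.
    move/eqP; rewrite muln_eq1 => /andP[/eqP -> _].
    by rewrite muln_gt0 expn_gt0 (cardD1 0) !inE eqxx.
  rewrite /E cards2 (_ : 0 != ones N1 N2); last first.
    apply/eqP => /rowP/(_ (Ordinal N0))/eqP; by rewrite !mxE.
  rewrite -expnSr -(@leq_exp2r _ _ 2) // -!mulnn card2 mulnn -expnM leq_exp2l //.
  by rewrite mulnC.
exists M; split=> // D0 cD0 D01 D0M; apply: Mgen => //.
by rewrite subUset !sub1set code0.
Qed.

Lemma mcoeff_ccwe C k :
  (ccwe K m C)@_k = #|[set M : mat | over C M && (mon M == k)]|%:R.
Proof.
rewrite /ccwe raddf_sum /= -sum1_card natr_sum big_mkcond [RHS]big_mkcond /=.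
apply: eq_bigr => M _; rewrite inE -/(over C M) nuX mcoeffX.
by case: (over C M); case: eqP.
Qed.

Lemma ccwe_free (R : {set {set word}}) (c : {set word} -> K) :
  (N1 + N2 <= 2 * m.+1)%N ->
  (forall D, D \in R -> DE_SD_code D) ->
  (forall D1 D2, D1 \in R -> D2 \in R -> code_equiv D1 D2 -> D1 = D2) ->
  \sum_(D in R) c D *: ccwe K m D = 0 -> forall D, D \in R -> c D = 0.
Proof.
move=> Nm RP Req c0 D DR; have [M [DM Mgen]] := self_dual_generators (RP D DR) Nm.
move/(congr1 (mcoeff (mon M))): c0; rewrite raddf_sum mcoeff0 (bigD1 D) //=.
rewrite big1 ?addr0 => [|D' /andP[D'R D'D]].
  move/eqP; rewrite mcoeffZ mcoeff_ccwe mulf_eq0 => /orP[/eqP//|].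
  rewrite pnatr_eq0 cards_eq0 => /eqP/setP/(_ M).
  by rewrite !inE DM eqxx.
rewrite mcoeffZ mcoeff_ccwe; apply/eqP; rewrite mulf_eq0; apply/orP; right.
rewrite pnatr_eq0 cards_eq0; apply: contraNT D'D => /set0Pn[M'].
rewrite inE => /andP[D'M' /eqP /esym /mon_eq_col_perm[s [sb M'E]]].
have card_sd C : C \in R -> (#|C| * #|C|)%N = (2 ^ (N1 + N2))%N.
  move/RP/DE_SD_admissible => /andP[aC /eqP sC].
  by rewrite -{2}sC (card_dual K) //; apply: admissible_code.
have /DE_SD_admissible/andP[aD' _] := RP D' D'R.
have cD' := admissible_code aD'.
have sub : D \subset [set x | permute_word s x \in D'].
  apply: Mgen.
  - apply/codebP; rewrite /codeb inE; apply/andP; split.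
      rewrite (_ : permute_word s 0 = 0) ?code0 //.
      by apply/rowP => j; rewrite !mxE.
    apply/forall_inP => x; rewrite inE => xD; apply/forall_inP => y; rewrite !inE => yD.
    rewrite (_ : permute_word s (x + y) = permute_word s x + permute_word s y).
      exact: codeD.
    by apply/rowP => j; rewrite !mxE.
  - rewrite inE (_ : permute_word s _ = ones N1 N2) ?admissible_ones //.
    by apply/rowP => j; rewrite !mxE.
  - apply/forallP => i; rewrite inE.
    have := forallP D'M' i; rewrite M'E.
    suff -> : row i (col_perm s M) = permute_word s (row i M) by [].
    by apply/rowP => j; rewrite !mxE.
apply/eqP/esym; apply: Req => //; exists s; split=> //.
apply/eqP; rewrite eq_sym eqEcard; apply/andP; split.
  by apply/subsetP => y /imsetP[x /(subsetP sub)]; rewrite inE => xD ->.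
rewrite card_imset; last by move=> x y; rewrite !permute_wordE; apply: col_perm_inj.
by rewrite -leq_sqr -!mulnn !card_sd.
Qed.

Lemma ccwe_span_representatives (R : {set {set word}}) (c : {set word} -> K) :
  (forall C, DE_SD_code C -> exists D, D \in R /\ code_equiv C D) ->
  (forall C, ~ DE_SD_code C -> c C = 0) ->
  exists c' : {set word} -> K,
    \sum_C c C *: ccwe K m C = \sum_(D in R) c' D *: ccwe K m D.
Proof.
(* [code_equiv] is not boolean, so the representative is picked by equality of enumerators, which is
   what regrouping the sum requires. *)
move=> RP c0; pose rep C := [pick D in R | ccwe K m C == ccwe K m D].
have repE C : self_dualb C -> exists2 D, rep C = Some D & D \in R /\ ccwe K m C = ccwe K m D.
  move=> /DE_SD_admissible/RP[D [DR CD]]; rewrite /rep.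
  case: pickP => [D' /andP[D'R /eqP CD']|/(_ D)]; first by exists D'.
  by rewrite DR (ccwe_equiv CD) eqxx.
pose f C := odflt C (rep C).
exists (fun D => \sum_(C | self_dualb C && (f C == D)) c C).
rewrite (bigID (@self_dualb N1 N2)) /= [X in _ + X]big1 ?addr0; last first.
  by move=> C nC; rewrite c0 ?scale0r // => /DE_SD_admissible; apply/negP.
rewrite (partition_big f (mem R)) /= => [|C /repE[D fD [DR _]]]; last by rewrite /f fD.
apply: eq_bigr => D _; rewrite scaler_suml; apply: eq_bigr => C /andP[/repE[D' fD' [_ ->]]].
by rewrite /f fD' /= => /eqP ->.
Qed.

End Equivalence.

Theorem mainTheorem9 (K : numClosedFieldType) (m N1 N2 : nat)
  (hm : (1 <= m)%N) :
  (* each ccwe(C(m)) lies in the space of X_m-invariant polynomials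
     homogeneous of degree (N1,N2) ... *)
  (forall C : {set word N1 N2}, DE_SD_code C ->
     clifford_invariant (ccwe K m C) /\ bihomog N1 N2 (ccwe K m C)) /\
  (* ... and they span it *)
  (forall p : cpoly K m, clifford_invariant p -> bihomog N1 N2 p ->
     exists c : {set word N1 N2} -> K,
       (forall C, ~ DE_SD_code C -> c C = 0) /\
       p = \sum_(C : {set word N1 N2}) c C *: ccwe K m C) /\
  (* if m+1 >= (N1+N2)/2, representatives of the equivalence classes give
     a basis *)
  ((N1 + N2 <= 2 * m.+1)%N ->
   forall R : {set {set word N1 N2}},
     (forall D, D \in R -> DE_SD_code D) ->
     (forall C, DE_SD_code C -> exists D, D \in R /\ code_equiv C D) ->
     (forall D1 D2, D1 \in R -> D2 \in R -> code_equiv D1 D2 -> D1 = D2) ->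
     (forall c : {set word N1 N2} -> K,
        \sum_(D in R) c D *: ccwe K m D = 0 -> forall D, D \in R -> c D = 0) /\
     (forall p : cpoly K m, clifford_invariant p -> bihomog N1 N2 p ->
        exists c : {set word N1 N2} -> K,
          p = \sum_(D in R) c D *: ccwe K m D)).
Proof.
(* Writing m as a successor provides the row 0 on which the Hadamard generator acts. *)
case: m hm => // m _; split=> [C sdC|].
  by split; [exact: ccwe_invariant|rewrite ccweE; exact: tens_bihomog].
split=> [|Nm R RP Rex Req]; first exact: ccwe_span.
split=> [c c0|p pinv phom]; first exact: (ccwe_free Nm RP Req c0).
have [c [c0 ->]] := ccwe_span pinv phom.
exact: ccwe_span_representatives.
Qed.
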